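(* Let $X$ be a super-Brownian motion in $\mathbb{R}^2$ with initial value $X_0=\delta_0$, let $L_t^x$ denote its local time at the point $x\in\mathbb{R}^2\setminus\{0\}$ and time $t$, and let $c_2=\frac1\pi$. Then for every $0<t<\infty$, $$\limsup_{x\to0}E\Big|L_t^x-c_2\log\frac{1}{|x|}\Big|<\infty.$$
   Context: $M_F=M_F(\mathbb{R}^d)$ is the space of finite Borel measures on $\mathbb{R}^d$ with the topology of weak convergence; $\mu(\phi)=\int\phi\,d\mu$. Here $d=2$. Super-Brownian motion $X$ started at $\mu\in M_F$ is the continuous $M_F$-valued adapted strong Markov process on a filtered probability space $(\Omega,\mathcal{F},\mathcal{F}_t,P)$, unique in law, with $X_0=\mu$ a.s. solving the martingale problem: for every $\phi\in C_b^2(\mathbb{R}^d)$, $X_t(\phi)=X_0(\phi)+M_t(\phi)+\int_0^t X_s(\frac{\Delta}{2}\phi)\,ds$, where $M_t(\phi)$ is a continuous $\mathcal{F}_t$-martingale with $M_0(\phi)=0$ and quadratic variation $[M(\phi)]_t=\int_0^t X_s(\phi^2)\,ds$. With $p_t(x)=(2\pi t)^{-d/2}e^{-|x|^2/2t}$ and $p_\epsilon^x(y)=p_\epsilon(y-x)$, the local time of $X$ at $x\ne0$ and time $t$ is $L_t^x=\lim_{\epsilon\to0}\int_0^t X_s(p_\epsilon^x)\,ds$; it satisfies $\int_0^t X_s(\phi)\,ds=\int_{\mathbb{R}^d}L_t^x\phi(x)\,dx$ for $\phi\in C_b(\mathbb{R}^d)$. *)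

(* Defs.v *)
From HB Require Import structures.
From mathcomp Require Import all_boot all_order all_algebra.
From mathcomp Require Import all_classical all_reals all_analysis.

Set Implicit Arguments.
Unset Strict Implicit.
Unset Printing Implicit Defensive.

Import Order.TTheory GRing.Theory Num.Theory.
Import numFieldNormedType.Exports.

Local Open Scope classical_set_scope.
Local Open Scope ring_scope.

(* Time is indexed by [R]; only times [0 <= t] are ever constrained. *)

Section plane.
Context {R : realType}.
Implicit Types (x : R * R) (f : R * R -> R).

(* The norm of the library on [R * R] is the sup norm. *)
Definition enorm x : R := Num.sqrt (x.1 ^+ 2 + x.2 ^+ 2).

Definition Cb f : Prop :=
  continuous f /\ exists K : R, forall x, `|f x| <= K.

Definition axes : seq (R * R) := [:: (1, 0); (0, 1)].

Definition Cb1 f : Prop :=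
  Cb f /\ forall v, v \in axes -> (forall x, derivable f x v) /\ Cb ('D_v f).

Definition Cb2 f : Prop := Cb1 f /\ forall v, v \in axes -> Cb1 ('D_v f).

Definition laplacian f x : R := \sum_(v <- axes) 'D_v ('D_v f) x.

Definition heat_kernel (t : R) x : R :=
  (2 * pi * t)^-1 * expR (- enorm x ^+ 2 / (2 * t)).

End plane.

Section finite_measures.
Variable R : realType.

Definition MF : Type := {finite_measure set (R * R)%type -> \bar R}.

HB.instance Definition _ := gen_eqMixin MF.
HB.instance Definition _ := gen_choiceMixin MF.
HB.instance Definition _ := isPointed.Build MF mzero.

Definition pairing (mu : MF) (f : R * R -> R) : R := \int[mu]_y f y.

Definition pairings (mu : MF) :
    prod_topology (fun _ : set_type [set f | @Cb R f] => (R : topologicalType)) :=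
  fun f => pairing mu (set_val f).

HB.instance Definition _ := Topological.copy MF (initial_topology pairings).

(* [MF] with its Borel sigma-algebra. A library measure also carries arbitrary
   values on the non-measurable sets; these are seen neither by the topology
   nor by this sigma-algebra. *)
Definition borelMF := g_sigma_algebraType (@open MF).

End finite_measures.

Section processes.
Context {R : realType} {d : measure_display} {Omega : measurableType d}.
Variables (P : probability Omega R) (F : R -> set_system Omega).

Definition measurable_wrt d' (T : measurableType d') (G : set_system Omega)
    (Y : Omega -> T) : Prop :=
  forall A, measurable A -> G (Y @^-1` A).

Definition filtration : Prop :=
  [/\ forall t : R, 0 <= t -> sigma_algebra setT (F t),
      forall t : R, 0 <= t -> F t `<=` measurable &
      forall s t : R, 0 <= s -> s <= t -> F s `<=` F t].

Definition adapted d' (T : measurableType d') (Y : R -> Omega -> T) : Prop :=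
  forall t : R, 0 <= t -> measurable_wrt (F t) (Y t).

Definition continuous_paths (T : topologicalType) (Y : R -> Omega -> T) : Prop :=
  forall w, {within `[0, +oo[, continuous (fun t => Y t w)}.

Definition cond_expectation (G : set_system Omega) (Y Z : Omega -> R) : Prop :=
  [/\ measurable_wrt G Z, P.-integrable setT (EFin \o Z) &
      forall A, G A ->
        (\int[P]_(w in A) (Z w)%:E = \int[P]_(w in A) (Y w)%:E)%E].

Definition martingale (M : R -> Omega -> R) : Prop :=
  [/\ adapted M,
      forall t : R, 0 <= t -> P.-integrable setT (EFin \o M t) &
      forall s t : R, 0 <= s -> s <= t -> cond_expectation (F s) (M t) (M s)].

Definition stopping_time (tau : Omega -> \bar R) : Prop :=
  (forall w, (0 <= tau w)%E) /\
  forall t : R, 0 <= t -> F t [set w | (tau w <= t%:E)%E].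

Definition stopped_sigma_algebra (tau : Omega -> \bar R) : set_system Omega :=
  [set A | measurable A /\
     forall t : R, 0 <= t -> F t (A `&` [set w | (tau w <= t%:E)%E])].

Definition stopped (tau : Omega -> \bar R) (M : R -> Omega -> R) :
    R -> Omega -> R :=
  fun t w => M (fine (Order.min t%:E (tau w))) w.

Definition continuous_local_martingale (N : R -> Omega -> R) : Prop :=
  [/\ adapted N, continuous_paths N &
    exists tau : nat -> Omega -> \bar R,
    [/\ forall n, stopping_time (tau n),
        {ae P, forall w, {homo tau ^~ w : m n / (m <= n)%N >-> (m <= n)%E} /\
                         tau n w @[n --> \oo] --> +oo%E} &
        forall n, martingale (stopped (tau n) (fun t w => N t w - N 0 w))]].

(* For a continuous local martingale [M], the process [A] below is unique up
   to indistinguishability. *)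
Definition quadratic_variation (M A : R -> Omega -> R) : Prop :=
  [/\ adapted A, continuous_paths A, {ae P, forall w, A 0 w = 0},
      forall w, {in `[0, +oo[ &, {homo A ^~ w : s t / s <= t}} &
      continuous_local_martingale (fun t w => M t w ^+ 2 - A t w)].

Definition markov_semigroup d' (S : measurableType d')
    (Q : R -> R.-pker S ~> S) : Prop :=
  (forall x A, measurable A -> Q 0 x A = \d_x A) /\
  (forall (s t : R) x A, 0 <= s -> 0 <= t -> measurable A ->
     (Q (s + t)%R x A = \int[Q s x]_y Q t y A)%E).

Definition strong_markov d' (S : measurableType d') (Y : R -> Omega -> S) :
    Prop :=
  exists Q : R -> R.-pker S ~> S, markov_semigroup Q /\
    forall tau, stopping_time tau ->
    forall B, stopped_sigma_algebra tau B ->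
      B `<=` [set w | (tau w < +oo)%E] ->
    forall (t : R) A, 0 <= t -> measurable A ->
      (P (B `&` [set w | A (Y (fine (tau w) + t)%R w)]) =
       \int[P]_(w in B) Q t (Y (fine (tau w)) w) A)%E.

Definition time_integral (X : R -> Omega -> MF R) (f : R * R -> R) (t : R)
    (w : Omega) : R :=
  \int[lebesgue_measure]_(s in `[0, t]) pairing (X s w) f.

Definition martingale_problem (X : R -> Omega -> MF R) : Prop :=
  forall phi : R * R -> R, Cb2 phi ->
  exists M : R -> Omega -> R,
  [/\ {ae P, forall w, forall t : R, 0 <= t ->
         pairing (X t w) phi = pairing (X 0 w) phi + M t w
           + time_integral X (fun x => laplacian phi x / 2) t w},
      martingale M, continuous_paths M, {ae P, forall w, M 0 w = 0} &
      quadratic_variation M (time_integral X (fun x => phi x ^+ 2))].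

Definition super_brownian_motion (mu : MF R) (X : R -> Omega -> MF R) : Prop :=
  [/\ filtration /\ adapted (X : R -> Omega -> borelMF R),
      continuous_paths X,
      strong_markov (X : R -> Omega -> borelMF R),
      {ae P, forall w, forall A, measurable A -> X 0 w A = mu A} &
      martingale_problem X].

Definition local_time (X : R -> Omega -> MF R) (L : R -> R * R -> Omega -> R) :
    Prop :=
  forall (t : R) (x : R * R), 0 <= t -> x != 0 ->
    measurable_fun setT (L t x) /\
    {ae P, forall w,
      time_integral X (fun y => heat_kernel eps (y - x)) t w @[eps --> 0^'+]
        --> L t x w}.

End processes.

(* Main.v *)
Require Import Defs.
From HB Require Import structures.
From mathcomp Require Import all_boot all_order all_algebra.
From mathcomp Require Import all_classical all_reals all_analysis.
From mathcomp Require Import measurable_realfun ring lra.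

Set Implicit Arguments.
Unset Strict Implicit.
Unset Printing Implicit Defensive.

Import Order.TTheory GRing.Theory Num.Theory.
Import numFieldNormedType.Exports.

Local Open Scope classical_set_scope.
Local Open Scope ring_scope.

(** Write [p_s] for the heat kernel.  The Green function
    [phi_x(y) = pi^-1 ln (1/|y - x|)] of the plane satisfies
    [(Laplacian/2) phi_x = - delta_x]; testing the martingale problem against it
    gives, formally, Tanaka's formula
    [L_t^x - pi^-1 ln (1/|x|) = M_t(phi_x) - X_t(phi_x)].
    The theorem says that both terms on the right have first moments bounded
    uniformly in [x], because a logarithmic singularity is square integrable for
    the mean occupation measure of [X].

    To obtain admissible test functions, [phi_x] is replaced by the integral of
    [p_s(y - x)] over [1/(2b) <= s <= 1/2].  This [potential] is smooth and
    bounded, its half Laplacian is exactly [p_(1/2) - p_(1/(2b))], centred at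
    [x] ([potential_Cb2]), and its value at the origin is
    [pi^-1 ln (1/|x|) + O(1)] for [|x| <= 1] and [b >= 1/|x|^2]
    ([potential_log]).  The
    martingale problem thus expresses the mollified local time
    [int_0^t X_s(p_(1/(2b))^x) ds] through a martingale term, a terminal term
    and a bounded source ([mean_heat_occupation]); Fatou's lemma along
    [b -> +oo] then transfers the bound to [L_t^x].

    The moments are bounded by test functions alone, without computing the mean
    measure of [X_t].
    - The martingale term: [E M_t^2 <= E int_0^t X_s(phi^2) ds]
      ([second_moment_le]).  A bounded function [h] behaving like [|y - x|] near
      [x] has a Laplacian of order [1/|y - x|], which dominates [phi^2]
      ([barrier_Cb2], [potential_sqr_le]); since [E X_t(h)] is bounded, so is
      the mean occupation integral of [phi^2]
      ([mean_occupation_potential_sqr]).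
    - The terminal term: [(Laplacian/2) phi <= 1], so [s |-> E X_s(phi)] is
      nonincreasing up to a bounded error; its value at [t] is then controlled
      by its average over [[0, t]], that is, by the mean occupation integral
      of [phi <= 1 + phi^2] ([mean_potential]). *)

(** * Radial test functions in the plane *)

Section radial.
Context {R : realType}.
Implicit Types (x y v w : R * R) (q t : R).

Definition sqdist x y : R := (y.1 - x.1) ^+ 2 + (y.2 - x.2) ^+ 2.

Definition dotdiff v x y : R := v.1 * (y.1 - x.1) + v.2 * (y.2 - x.2).

Definition dot v w : R := v.1 * w.1 + v.2 * w.2.

Lemma sqdist_ge0 x y : 0 <= sqdist x y.
Proof. by rewrite addr_ge0// sqr_ge0. Qed.

(** Directional derivatives in the plane are derivatives along a line, so that
    one-variable calculus applies to them. *)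
Lemma is_derive_line (f : R * R -> R) y v (l : R) :
  is_derive (0 : R) (1 : R) (fun t => f (t *: v + y)) l -> is_derive y v f l.
Proof.
have E : (fun h : R => h^-1 *: (((fun t : R => f (t *: v + y)) \o shift 0)
             (h *: 1) - f (0 *: v + y))) =
    (fun h : R => h^-1 *: ((f \o shift y) (h *: v) - f y)).
  by apply/funext => h /=; rewrite addr0 scale0r add0r scaler1.
case => H1 H2; split.
  by rewrite /derivable -E.
by rewrite /derive -E.
Qed.

Lemma continuous_sqdist x : continuous (sqdist x).
Proof.
move=> y; rewrite /sqdist; apply: cvgD; apply: cvgM;
  (apply: cvgB; last exact: cvg_cst); first [exact: cvg_fst | exact: cvg_snd].
Qed.

Lemma continuous_dotdiff v x : continuous (dotdiff v x).
Proof.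
move=> y; rewrite /dotdiff; apply: cvgD; apply: cvgM; first [exact: cvg_cst |
  (apply: cvgB; last exact: cvg_cst); first [exact: cvg_fst | exact: cvg_snd]].
Qed.

Lemma is_derive_sqdist x y v :
  is_derive (0 : R) (1 : R) (fun t => sqdist x (t *: v + y)) (2 * dotdiff v x y).
Proof.
rewrite /sqdist /=.
apply: is_derive_eq; rewrite /dotdiff /=.
rewrite /GRing.scale /=; ring.
Qed.

Lemma is_derive_dotdiff w x y v :
  is_derive (0 : R) (1 : R) (fun t => dotdiff w x (t *: v + y)) (dot w v).
Proof.
rewrite /dotdiff /=.
apply: is_derive_eq; rewrite /dot /=.
rewrite /GRing.scale /=; ring.
Qed.

Lemma is_derive_radial (K K1 : R -> R) x y v :
  (forall q, 0 <= q -> is_derive q 1 K (K1 q)) ->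
  is_derive y v (K \o sqdist x) (2 * dotdiff v x y * K1 (sqdist x y)).
Proof.
move=> dK; apply: is_derive_line.
have := @is_derive1_comp R K (fun t => sqdist x (t *: v + y)) 0
  (K1 (sqdist x (0 *: v + y))) (2 * dotdiff v x y)
  (dK _ (sqdist_ge0 _ _)) (is_derive_sqdist x y v).
by rewrite scale0r add0r mulrC.
Qed.

Lemma is_derive_radial2 (K1 K2 : R -> R) x y v w :
  (forall q, 0 <= q -> is_derive q 1 K1 (K2 q)) ->
  is_derive y w (fun z => 2 * dotdiff v x z * K1 (sqdist x z))
   (2 * dot v w * K1 (sqdist x y)
    + 4 * dotdiff v x y * dotdiff w x y * K2 (sqdist x y)).
Proof.
move=> dK; apply: is_derive_line.
have D1 := @is_derive1_comp R K1 (fun t => sqdist x (t *: w + y)) 0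
  (K2 (sqdist x (0 *: w + y))) (2 * dotdiff w x y)
  (dK _ (sqdist_ge0 _ _)) (is_derive_sqdist x y w).
have D2 := is_derive_dotdiff v x y w.
apply: is_derive_eq.
rewrite scale0r add0r /GRing.scale /=; ring.
Qed.

Lemma dotdiff_axes v x y : v \in axes -> dotdiff v x y ^+ 2 <= sqdist x y.
Proof.
rewrite !inE => /orP[]/eqP ->; rewrite /dotdiff /sqdist /=.
  by rewrite mul1r mul0r addr0 lerDl sqr_ge0.
by rewrite mul1r mul0r add0r lerDr sqr_ge0.
Qed.

Lemma dot_axes v w : v \in axes -> w \in axes -> `|dot v w : R| <= 1.
Proof.
by rewrite !inE => /orP[]/eqP -> /orP[]/eqP ->; rewrite /dot /=;
  rewrite !(mulr0, mul0r, mulr1, addr0, add0r) ?normr0 ?normr1.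
Qed.

(** In terms of the squared distance [q], a radial function has no singularity
    at [y = x] and its planar Laplacian is [4 (q K')']; the decay of [K1] and
    [K2] compensates the factors [y_i - x_i] produced by the chain rule. *)
Lemma Cb2_radial (K K1 K2 : R -> R) (C : R) x :
  (forall q, 0 <= q -> is_derive q 1 K (K1 q)) ->
  (forall q, 0 <= q -> is_derive q 1 K1 (K2 q)) ->
  (forall q, 0 <= q -> {for q, continuous K2}) ->
  (forall q, 0 <= q -> `|K q| <= C) ->
  (forall q, 0 <= q -> `|K1 q| * (1 + q) <= C) ->
  (forall q, 0 <= q -> `|K2 q| * (1 + q) <= C) ->
  Cb2 (K \o sqdist x) /\
  forall y, laplacian (K \o sqdist x) y =
    4 * (sqdist x y * K2 (sqdist x y) + K1 (sqdist x y)).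
Proof.
move=> dK dK1 cK2 bK bK1 bK2.
have D1 v y := @is_derive_radial _ _ x y v dK.
have D2 v w y := @is_derive_radial2 _ _ x y v w dK1.
have E1 v : 'D_v (K \o sqdist x) =
    fun z => 2 * dotdiff v x z * K1 (sqdist x z).
  by apply/funext => z; case: (D1 v z).
have E2 v w : 'D_w (fun z => 2 * dotdiff v x z * K1 (sqdist x z)) =
    fun y => (2 * dot v w * K1 (sqdist x y)
    + 4 * dotdiff v x y * dotdiff w x y * K2 (sqdist x y)).
  by apply/funext => z; case: (D2 v w z).
have cK q : 0 <= q -> {for q, continuous K}.
  move=> q0; apply: differentiable_continuous; apply/derivable1_diffP.
  by case: (dK q q0).
have cK1 q : 0 <= q -> {for q, continuous K1}.
  move=> q0; apply: differentiable_continuous; apply/derivable1_diffP.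
  by case: (dK1 q q0).
have comp (G : R -> R) : (forall q, 0 <= q -> {for q, continuous G}) ->
    continuous (G \o sqdist x).
  move=> cG y; apply: continuous_comp; first exact: continuous_sqdist.
  exact/cG/sqdist_ge0.
have CbK : Cb (K \o sqdist x).
  by split; [exact: comp|exists C => y; exact/bK/sqdist_ge0].
have CbK1 v : v \in axes -> Cb (fun z => 2 * dotdiff v x z * K1 (sqdist x z)).
  move=> va; split.
    move=> y; apply: cvgM; last exact: comp.
    by apply: cvgM; [exact: cvg_cst|exact: continuous_dotdiff].
  exists C => y; apply: le_trans (bK1 _ (sqdist_ge0 x y)).
  rewrite !normrM mulrC ler_wpM2l//.
  have := dotdiff_axes x y va; rewrite -real_normK ?num_real// normr_nat.
  have := sqr_ge0 (1 - `|dotdiff v x y|); nra.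
have CbK2 v w : v \in axes -> w \in axes ->
    Cb (fun y => (2 * dot v w * K1 (sqdist x y)
    + 4 * dotdiff v x y * dotdiff w x y * K2 (sqdist x y))).
  move=> va wa; split.
    move=> y; apply: cvgD; apply: cvgM; first exact: cvg_cst.
    - exact: comp.
    - apply: cvgM; last exact: continuous_dotdiff.
      by apply: cvgM; [exact: cvg_cst|exact: continuous_dotdiff].
    - exact: comp.
  exists (2 * C + 4 * C) => y.
  apply: le_trans (ler_normD _ _) _; rewrite !normrM !normr_nat.
  have q0 := sqdist_ge0 x y; have k1 := bK1 _ q0; have k2 := bK2 _ q0.
  have n1 := normr_ge0 (K1 (sqdist x y)).
  have n2 := normr_ge0 (K2 (sqdist x y)).
  apply: lerD.
    rewrite -mulrA ler_wpM2l//; apply: le_trans k1.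
    have := dot_axes va wa; have := normr_ge0 (dot v w); nra.
  rewrite -!mulrA ler_wpM2l//; apply: le_trans k2.
  have := dotdiff_axes x y va; have := dotdiff_axes x y wa.
  rewrite -(real_normK (num_real (dotdiff v x y))).
  rewrite -(real_normK (num_real (dotdiff w x y))).
  set a := `|dotdiff v x y|; set b := `|dotdiff w x y| => h1 h2.
  have h : a * b <= 1 + sqdist x y by have := sqr_ge0 (a - b); nra.
  by rewrite mulrA mulrC ler_wpM2l.
split.
  split.
    split=> // v va; rewrite E1; split; last exact: CbK1.
    by move=> z; case: (D1 v z).
  move=> v va; rewrite E1; split; first exact: CbK1.
  move=> w wa; rewrite E2; split; last exact: CbK2.
  by move=> z; case: (D2 v w z).
move=> y.
have E v : 'D_v ('D_v (K \o sqdist x)) y = 2 * dot v v * K1 (sqdist x y)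
    + 4 * dotdiff v x y * dotdiff v x y * K2 (sqdist x y).
  by rewrite E1; case: (D2 v v y).
rewrite /laplacian /axes !big_cons big_nil !E.
rewrite /dot /dotdiff /sqdist /=; ring.
Qed.

End radial.

(** * Truncated Laplace transforms *)

Section segment_integrals.
Context {R : realType}.
Notation mu := (@lebesgue_measure R).
Variables a b : R.
Hypothesis ab : a < b.
Implicit Types f g F : R -> R.

(** Two-sided continuity at each point of the segment, rather than continuity on
    the subspace: it is stable under the pointwise rules for limits. *)
Definition cont_on f := forall v, a <= v <= b -> {for v, continuous f}.

Lemma cont_on_within f : cont_on f -> {within `[a, b], continuous f}.
Proof.
move=> cf; apply: continuous_in_subspaceT => v /set_mem /=.
by rewrite in_itv/=; exact: cf.
Qed.

Lemma cont_on_integrable f :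
  cont_on f -> mu.-integrable `[a, b] (EFin \o f).
Proof.
move=> cf; apply: continuous_compact_integrable; first exact: segment_compact.
exact: cont_on_within.
Qed.

Lemma is_derive_continuous f (v l : R) : is_derive v 1 f l ->
  {for v, continuous f}.
Proof.
case=> df _; apply: differentiable_continuous.
exact/derivable1_diffP.
Qed.

Lemma cont_on_le_integral f g : cont_on f -> cont_on g ->
  (forall v, a <= v <= b -> f v <= g v) ->
  \int[mu]_(v in `[a, b]) f v <= \int[mu]_(v in `[a, b]) g v.
Proof.
move=> cf cg fg; apply: le_Rintegral => //.
- exact: (cont_on_integrable cf).
- exact: (cont_on_integrable cg).
Qed.

Lemma integral_derivative f F : cont_on f ->
  (forall v, a <= v <= b -> is_derive v 1 F (f v)) ->
  \int[mu]_(v in `[a, b]) f v = F b - F a.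
Proof.
move=> cf dF; rewrite /Rintegral (@continuous_FTC2 _ f F)//.
- exact: cont_on_within.
- split.
  + by move=> v /[!in_itv]/= /andP[av vb]; case: (dF v); rewrite ?ltW.
  + apply: cvg_at_right_filter; apply: (@is_derive_continuous _ _ (f a)).
    by apply: dF; rewrite lexx ltW.
  + apply: cvg_at_left_filter; apply: (@is_derive_continuous _ _ (f b)).
    by apply: dF; rewrite lexx ltW.
- move=> v /[!in_itv]/= /andP[av vb].
  by rewrite derive1E; case: (dF v) => //; rewrite !ltW.
Qed.

End segment_integrals.

Section laplace.
Context {R : realType}.
Notation mu := (@lebesgue_measure R).
Variable b : R.
Implicit Types (w : R -> R) (q : R).

(** The weights [1/v], [1] and [v] give the potential below and its first two
    derivatives; the bounded range of [v] makes them smooth in [q], and [v >= 1] makes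
    them decay like [1/(1 + q)]. *)
Definition laplace w q : R :=
  \int[mu]_(v in `[1, b]) (w v * expR (- (v * q))).

Lemma is_derive_expRM c (v : R) :
  is_derive v 1 (fun v => expR (- (v * c))) (- (c * expR (- (v * c)))).
Proof.
apply: is_derive_eq; rewrite /GRing.scale /=; ring.
Qed.

Lemma cont_on_laplace w q : cont_on 1 b w ->
  cont_on 1 b (fun v => w v * expR (- (v * q))).
Proof.
move=> cw v vb; apply: cvgM; first exact: cw.
exact: is_derive_continuous (is_derive_expRM _ _).
Qed.

Lemma cont_on_mulid w : cont_on 1 b w -> cont_on 1 b (fun v => v * w v).
Proof. by move=> cw v vb; apply: cvgM; [exact: cvg_id|exact: cw]. Qed.

Lemma laplace_derive w q : cont_on 1 b w ->
  is_derive q 1 (laplace w) (- laplace (fun v => v * w v) q).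
Proof.
move=> cw.
pose f q v := w v * expR (- (v * q)).
(* For [p > q - 1] the exponent [- v p] is at most [v (|q| + 1)]. *)
pose G v : R := `|v * w v| * expR (- (v * - (`|q| + 1))).
have mB : measurable `[1, b]%classic by [].
have Ia : `]q - 1, q + 1[%classic q by rewrite /= in_itv/=; apply/andP; split; lra.
have D (p v : R) : is_derive p 1 (f ^~ v) (- (v * w v * expR (- (v * p)))).
  rewrite /f; apply: is_derive_eq; rewrite /GRing.scale /=; ring.
have intf p : `]q - 1, q + 1[%classic p -> mu.-integrable `[1, b] (EFin \o f p).
  by move=> _; apply: cont_on_integrable; exact: cont_on_laplace.
have derf p v : `]q - 1, q + 1[%classic p -> `[1, b]%classic v ->
    derivable (f ^~ v) p 1 by move=> _ _; case: (D p v).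
have G0 v : 0 <= G v by rewrite mulr_ge0// expR_ge0.
have iG : mu.-integrable `[1, b] (EFin \o G).
  apply: cont_on_integrable => v vb; apply: cvgM.
    by apply: cvg_norm; exact: cont_on_mulid.
  exact: is_derive_continuous (is_derive_expRM _ _).
have ub p v : `]q - 1, q + 1[%classic p -> `[1, b]%classic v ->
    `|partial1of2 f p v| <= G v.
  rewrite /= !in_itv/= => /andP[p1 p2] /andP[v1 v2].
  rewrite partial1of2E; case: (D p v) => _ ->.
  rewrite normrN normrM ler_wpM2l// ger0_norm ?expR_ge0// ler_expR.
  have : - p <= `|q| + 1 by have := ler_norm (- q); rewrite normrN; lra.
  move=> h; rewrite -2!mulrN opprK ler_wpM2l//; lra.
split.
  exact: (@derivable_under_integral R _ _ mu f _ mB q _ _ Ia intf derf G G0 iG ub).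
have := @differentiation_under_integral R _ _ mu f _ mB q _ _ Ia intf derf G G0 iG ub.
rewrite derive1E => ->.
rewrite /laplace -mulN1r -RintegralZl//; last first.
  by apply: cont_on_integrable; apply: cont_on_laplace; exact: cont_on_mulid.
apply: eq_Rintegral => v _; rewrite partial1of2E; case: (D q v) => _ ->.
by rewrite mulN1r.
Qed.

Lemma laplace_ge0 w q : (forall v, 1 <= v <= b -> 0 <= w v) -> 0 <= laplace w q.
Proof.
move=> w0; apply: Rintegral_ge0 => v; rewrite /= in_itv/= => vb.
by rewrite mulr_ge0 ?expR_ge0 ?w0.
Qed.

(** For [v >= 1], [1 + q <= 1 + v q <= exp (v q)]. *)
Lemma laplace_decay w q : cont_on 1 b w -> 0 <= q ->
  (forall v, 1 <= v <= b -> 0 <= w v) ->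
  laplace w q * (1 + q) <= \int[mu]_(v in `[1, b]) w v.
Proof.
move=> cw q0 w0; rewrite /laplace -RintegralZr//; last first.
  by apply: cont_on_integrable; exact: cont_on_laplace.
apply: cont_on_le_integral => //.
  by move=> v vb; apply: cvgM; [exact: cont_on_laplace|exact: cvg_cst].
move=> v vb; rewrite -mulrA ler_piMr ?w0//.
have : 1 + q <= expR (v * q).
  apply: le_trans (expR_ge1Dx _); rewrite lerD2l ler_peMl//.
  by case/andP: vb.
rewrite expRN -ler_pdivlMl ?invr_gt0 ?expR_gt0// invrK mulr1; exact.
Qed.

End laplace.

(** * The smoothed Green function *)

Section potential.
Context {R : realType}.
Notation mu := (@lebesgue_measure R).
Variable b : R.
Hypothesis b1 : 1 < b.
Implicit Types (q v : R) (x y : R * R).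

(** The heat kernel [(2 pi s)^-1 exp (- q / (2 s))] integrated over
    [1/(2b) <= s <= 1/2], after the substitution [v = 1/(2s)]. *)
Definition potential q : R := (2 * pi)^-1 * laplace b (fun v => v^-1) q.

Let w1 v : R := v * v^-1.
Let w2 v : R := v * w1 v.

Let cw0 : cont_on 1 b (fun v : R => v^-1).
Proof.
move=> v /andP[v1 _]; apply: cvgV; last exact: cvg_id.
by rewrite gt_eqF// (lt_le_trans ltr01).
Qed.
Let cw1 : cont_on 1 b w1. Proof. exact: cont_on_mulid. Qed.
Let cw2 : cont_on 1 b w2. Proof. exact: cont_on_mulid. Qed.

Let w1_ge0 v : 1 <= v <= b -> 0 <= w1 v.
Proof. by case/andP=> v1 _; rewrite mulr_ge0 ?invr_ge0//; lra. Qed.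
Let w2_ge0 v : 1 <= v <= b -> 0 <= w2 v.
Proof.
move=> vb; rewrite mulr_ge0 ?w1_ge0//.
by case/andP: vb => v1 _; lra.
Qed.
Let w0_ge0 v : 1 <= v <= b -> 0 <= v^-1.
Proof. by case/andP=> v1 _; rewrite invr_ge0; lra. Qed.

Let pi2_gt0 : 0 < (2 * pi)^-1 :> R.
Proof. by rewrite invr_gt0 mulr_gt0 ?pi_gt0. Qed.

Let F1 q : R := - ((2 * pi)^-1 * laplace b w1 q).
Let F2 q : R := (2 * pi)^-1 * laplace b w2 q.

Let dF q : is_derive q 1 potential (F1 q).
Proof.
have D := laplace_derive q cw0; rewrite -/w1 in D.
rewrite /potential; apply: is_derive_eq.
by rewrite /F1 /GRing.scale /=; ring.
Qed.

Let dF1 q : is_derive q 1 F1 (F2 q).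
Proof.
have D := laplace_derive q cw1; rewrite -/w2 in D.
rewrite /F1; apply: is_derive_eq.
by rewrite /F2 /GRing.scale /=; ring.
Qed.

Let cF2 q : {for q, continuous F2}.
Proof.
have D := laplace_derive q cw2.
apply: cvgM; first exact: cvg_cst.
exact: is_derive_continuous D.
Qed.

Lemma potential_ge0 q : 0 <= potential q.
Proof. by rewrite mulr_ge0 ?(ltW pi2_gt0)//; exact: laplace_ge0. Qed.

(* [(1 - v q) exp (- v q)] is the derivative of [v exp (- v q)] in [v]. *)
Let laplace_eq q : q * F2 q + F1 q = (2 * pi)^-1 * (expR (- q) - b * expR (- (b * q))).
Proof.
rewrite /F1 /F2.
transitivity ((2 * pi)^-1 * (q * laplace b w2 q - laplace b w1 q)); first by ring.
congr (_ * _).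
have i1 := cont_on_laplace (q := q) cw1.
have i2 := cont_on_laplace (q := q) cw2.
rewrite /laplace -RintegralZl//; last exact: cont_on_integrable.
rewrite -RintegralB//; last 2 first.
- apply: cont_on_integrable => v vb; apply: cvgM; first exact: cvg_cst.
  exact: i2.
- exact: cont_on_integrable.
have cg : cont_on 1 b (fun v => q * (w2 v * expR (- (v * q)))
    - w1 v * expR (- (v * q))).
  move=> v vb; apply: cvgB; last exact: i1.
  by apply: cvgM; [exact: cvg_cst|exact: i2].
have dG v : 1 <= v <= b -> is_derive v 1 (fun v => - (v * expR (- (v * q))))
    (q * (w2 v * expR (- (v * q))) - w1 v * expR (- (v * q))).
  move=> /andP[v1 _].
  have v0 : v != 0 by rewrite gt_eqF// (lt_le_trans ltr01).
  have D := is_derive_expRM q v.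
  by apply: is_derive_eq; rewrite /w2 /w1 /GRing.scale /= divff//; ring.
by rewrite (integral_derivative b1 cg dG) !mul1r; ring.
Qed.

(** The half Laplacian of [p_s] is its derivative in [s], so that integrating in
    [s] leaves the difference of two heat kernels. The one at time [1/2] is
    bounded and the one at time [1/(2b)] approximates the Dirac mass. *)
Lemma potential_Cb2 x :
  Cb2 (potential \o sqdist x) /\
  forall y, laplacian (potential \o sqdist x) y / 2 =
    pi^-1 * expR (- sqdist x y) - heat_kernel (2 * b)^-1 (y - x).
Proof.
pose C0 := \int[mu]_(v in `[1, b]) v^-1.
pose C1 := \int[mu]_(v in `[1, b]) w1 v.
pose C2 := \int[mu]_(v in `[1, b]) w2 v.
have p0 := pi2_gt0.
have C0_ge0 : 0 <= C0 by apply: Rintegral_ge0 => v; rewrite /= in_itv/=; exact: w0_ge0.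
have C1_ge0 : 0 <= C1 by apply: Rintegral_ge0 => v; rewrite /= in_itv/=; exact: w1_ge0.
have C2_ge0 : 0 <= C2 by apply: Rintegral_ge0 => v; rewrite /= in_itv/=; exact: w2_ge0.
have [] := @Cb2_radial R potential F1 F2 ((2 * pi)^-1 * (C0 + C1 + C2)) x.
- by move=> q _.
- by move=> q _.
- by move=> q _.
- move=> q q0; rewrite ger0_norm ?potential_ge0// ler_wpM2l ?(ltW p0)//.
  have := laplace_decay cw0 q0 w0_ge0; rewrite -/C0.
  have := laplace_ge0 (b := b) q w0_ge0; nra.
- move=> q q0; rewrite normrN normrM (gtr0_norm p0) -mulrA ler_wpM2l ?(ltW p0)//.
  rewrite ger0_norm; last exact: laplace_ge0.
  by have := laplace_decay cw1 q0 w1_ge0; rewrite -/C1; lra.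
- move=> q q0; rewrite normrM (gtr0_norm p0) -mulrA ler_wpM2l ?(ltW p0)//.
  rewrite ger0_norm; last exact: laplace_ge0.
  by have := laplace_decay cw2 q0 w2_ge0; rewrite -/C2; lra.
move=> cb2 lap; split=> // y; rewrite lap laplace_eq.
have b0 : b != 0 by rewrite gt_eqF// (lt_trans ltr01).
have pin0 : pi != 0 :> R by rewrite gt_eqF// pi_gt0.
rewrite /heat_kernel /enorm sqr_sqrtr; last by rewrite addr_ge0 ?sqr_ge0.
have -> : - ((y - x).1 ^+ 2 + (y - x).2 ^+ 2) / (2 * (2 * b)^-1) =
    - (b * sqdist x y).
  by rewrite /sqdist /=; field.
by move: (pi : R) pin0 => c c0; field; rewrite b0 c0.
Qed.

(** The integral of [1/(v (1 + v q))] over [1 <= v <= b]: comparing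
    [exp (- s)] with [1/(1 + s)] makes the potential elementary. *)
Definition log_ratio q : R := ln (b * (1 + q) / (1 + b * q)).

Let integral_log_ratio q : 0 <= q ->
  cont_on 1 b (fun v => (v * (1 + v * q))^-1) /\
  \int[mu]_(v in `[1, b]) (v * (1 + v * q))^-1 = log_ratio q.
Proof.
move=> q0.
have pos v : 1 <= v <= b -> 0 < v /\ 0 < 1 + v * q.
  by case/andP=> v1 _; split; nra.
have cf : cont_on 1 b (fun v => (v * (1 + v * q))^-1).
  move=> v vb; have [v0 vq0] := pos _ vb.
  apply: cvgV; first by rewrite gt_eqF// mulr_gt0.
  apply: cvgM; first exact: cvg_id.
  apply: cvgD; first exact: cvg_cst.
  by apply: cvgM; [exact: cvg_id|exact: cvg_cst].
split=> //.
have dG v : 1 <= v <= b ->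
    is_derive v 1 (fun v => ln v - ln (1 + v * q)) (v * (1 + v * q))^-1.
  move=> vb; have [v0 vq0] := pos _ vb.
  have D1 := is_derive1_ln v0.
  have D2 : is_derive v 1 (fun v => 1 + v * q) q.
    by apply: is_derive_eq; rewrite /GRing.scale /=; ring.
  have D3 := @is_derive1_comp R (@ln R) (fun v => 1 + v * q) v _ _
    (is_derive1_ln vq0) D2.
  by apply: is_derive_eq; field; rewrite !gt_eqF.
rewrite (integral_derivative b1 cf dG) ln1 mul1r /log_ratio.
have [b0 bq0] := pos b (ltac:(by rewrite lexx ltW)).
have q1 : 0 < 1 + q by lra.
rewrite lnM ?posrE ?mulr_gt0 ?invr_gt0// lnM ?posrE// lnV ?posrE//; lra.
Qed.

Lemma potential_le q : 0 <= q -> potential q <= (2 * pi)^-1 * log_ratio q.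
Proof.
move=> q0; rewrite ler_wpM2l ?(ltW pi2_gt0)//.
have [cf <-] := integral_log_ratio q0.
apply: cont_on_le_integral => //; first exact: cont_on_laplace.
move=> v /andP[v1 _]; rewrite invfM ler_wpM2l ?invr_ge0//; first lra.
rewrite expRN lef_pV2 ?posrE ?expR_gt0 ?expR_ge1Dx//; nra.
Qed.

(* The left-hand side is [(1 - s)/(1 + s)^2], which is at most [1 - s] when
   [s <= 1] and nonpositive otherwise; the correction to [1/(1 + s)] divided by [v] is integrable
   uniformly in [b] and [q]. *)
Let expRN_ge (s : R) : 0 <= s -> (1 + s)^-1 - 2 * s / (1 + s) ^+ 2 <= expR (- s).
Proof.
move=> s0.
have p : 0 < (1 + s) ^+ 2 by rewrite exprn_gt0//; lra.
have E : (1 + s)^-1 - 2 * s / (1 + s) ^+ 2 = (1 - s) / (1 + s) ^+ 2.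
  by field; rewrite gt_eqF//; lra.
rewrite E ler_pdivrMr//.
have [s1|s1] := leP s 1; last first.
  by apply: le_trans (_ : 0 <= _); [lra|rewrite mulr_ge0 ?expR_ge0// ltW].
have e1 := expR_ge1Dx (- s).
have : expR (- s) <= expR (- s) * (1 + s) ^+ 2.
  by rewrite ler_peMr ?expR_ge0//; nra.
lra.
Qed.

Lemma potential_ge q : 0 <= q -> (2 * pi)^-1 * (log_ratio q - 2) <= potential q.
Proof.
move=> q0; rewrite ler_wpM2l ?(ltW pi2_gt0)//.
have pos v : 1 <= v <= b -> 0 < v /\ 0 < 1 + v * q.
  by case/andP=> v1 _; split; nra.
have [cf <-] := integral_log_ratio q0.
have dG v : 1 <= v <= b ->
    is_derive v 1 (fun v => - 2 * (1 + v * q)^-1) (2 * q / (1 + v * q) ^+ 2).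
  move=> vb; have [v0 vq0] := pos _ vb.
  have vq : 1 + v * q != 0 by rewrite gt_eqF.
  have D1 : is_derive v 1 (fun v => (1 + v * q)) q.
    by apply: is_derive_eq; rewrite /GRing.scale /=; ring.
  have D2 := @is_deriveV _ (fun v => (1 + v * q)) v q 1 vq D1.
  by apply: is_derive_eq; rewrite /GRing.scale /=; field.
have cg : cont_on 1 b (fun v => 2 * q / (1 + v * q) ^+ 2).
  move=> v vb; have [v0 vq0] := pos _ vb.
  apply: cvgM; first exact: cvg_cst.
  apply: cvgV; first by rewrite gt_eqF// exprn_gt0.
  have c : {for v, continuous (fun v : R => 1 + v * q)}.
    apply: cvgD; first exact: cvg_cst.
    by apply: cvgM; [exact: cvg_id|exact: cvg_cst].
  by apply: cvgM; exact: c.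
have I2 := integral_derivative b1 cg dG.
have [b0 bq0] := pos b (ltac:(by rewrite lexx ltW)).
apply: (@le_trans _ _ (\int[mu]_(v in `[1, b]) ((v * (1 + v * q))^-1
    - 2 * q / (1 + v * q) ^+ 2))).
  rewrite RintegralB//; [|exact: cont_on_integrable..].
  rewrite I2 mul1r lerD2l lerN2.
  have : 0 <= (1 + b * q)^-1 by rewrite invr_ge0 ltW.
  have : (1 + q)^-1 <= 1 by rewrite invf_le1; lra.
  lra.
apply: cont_on_le_integral.
- by move=> v vb; apply: cvgB; [exact: cf|exact: cg].
- exact: cont_on_laplace.
move=> v vb; have [v0 vq0] := pos _ vb.
have -> : (v * (1 + v * q))^-1 - 2 * q / (1 + v * q) ^+ 2 =
    v^-1 * ((1 + v * q)^-1 - 2 * (v * q) / (1 + v * q) ^+ 2).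
  by field; rewrite !gt_eqF.
rewrite ler_wpM2l ?invr_ge0 ?(ltW v0)// expRN_ge//.
by rewrite mulr_ge0// ltW.
Qed.

End potential.

(** * A barrier dominating the squared Green function *)

Section barrier.
Context {R : realType}.
Variable b : R.
Hypothesis b1 : 1 < b.
Implicit Types (q : R) (x y : R * R).

(** In the plane this is a smoothed and bounded version of [|y - x| - 1]; the
    shift by [b^-1] matches the scale at which the potential is smoothed. *)
Definition barrier q : R := - expR (- Num.sqrt (q + b^-1)).

Lemma normr_barrier_le1 q : `|barrier q| <= 1.
Proof.
by rewrite normrN ger0_norm ?expR_ge0// -[leRHS]expR0 ler_expR oppr_le0 sqrtr_ge0.
Qed.

Let sq q : R := Num.sqrt (q + b^-1).

Let bV_gt0 : 0 < b^-1. Proof. by rewrite invr_gt0 (lt_trans ltr01). Qed.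

Let sq_gt0 q : 0 <= q -> 0 < sq q.
Proof. by move=> q0; rewrite sqrtr_gt0; have := bV_gt0; lra. Qed.

Let sqK q : 0 <= q -> sq q ^+ 2 = q + b^-1.
Proof. by move=> q0; rewrite sqr_sqrtr//; have := bV_gt0; lra. Qed.

Let H1 q : R := expR (- sq q) / (2 * sq q).
Let H2 q : R := - (expR (- sq q) * ((4 * sq q ^+ 2)^-1 + (4 * sq q ^+ 3)^-1)).

Let dsq q : 0 <= q -> is_derive q 1 sq (2 * sq q)^-1.
Proof.
move=> q0.
have p : 0 < q + b^-1 by have := bV_gt0; lra.
have D : is_derive q 1 (fun q => q + b^-1) 1.
  by apply: is_derive_eq; rewrite addr0.
have := @is_derive1_comp R (@Num.sqrt R) (fun q => q + b^-1) q _ _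
  (is_derive1_sqrt p) D.
by rewrite mulr1.
Qed.

Let dexp q : 0 <= q ->
  is_derive q 1 (fun q => expR (- sq q)) (- expR (- sq q) / (2 * sq q)).
Proof.
move=> q0; have D := dsq q0.
by apply: is_derive_eq; rewrite mulrN mulNr.
Qed.

Let dH q : 0 <= q -> is_derive q 1 barrier (H1 q).
Proof.
move=> q0; have D := dexp q0.
rewrite /barrier; apply: is_derive_eq.
by rewrite /H1 mulNr opprK.
Qed.

Let dH1 q : 0 <= q -> is_derive q 1 H1 (H2 q).
Proof.
move=> q0; have D := dexp q0; have D2 := dsq q0.
have s0 : 2 * sq q != 0 by rewrite gt_eqF// mulr_gt0// sq_gt0.
have D3 : is_derive q 1 (fun q => 2 * sq q) (sq q)^-1.
  apply: is_derive_eq; rewrite /GRing.scale /=; field.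
  by rewrite gt_eqF// sq_gt0.
have D4 := @is_deriveV _ (fun q => 2 * sq q) q _ 1 s0 D3.
rewrite /H1; apply: is_derive_eq; rewrite /H2 /GRing.scale /=; field.
by rewrite gt_eqF// sq_gt0.
Qed.

Let cH2 q : 0 <= q -> {for q, continuous H2}.
Proof.
move=> q0; have c := is_derive_continuous (dsq q0).
have ce := is_derive_continuous (dexp q0).
have s0 := sq_gt0 q0.
apply: cvgN; apply: cvgM; first exact: ce.
apply: cvgD; (apply: cvgV; first by rewrite gt_eqF// mulr_gt0// exprn_gt0);
  (apply: cvgM; first exact: cvg_cst);
  by apply: (@continuous_comp _ _ _ sq (fun z => z ^+ _)) => //;
     exact: exprn_continuous.
Qed.

Let expRN_decay (s : R) : 0 < s -> expR (- s) * (1 + s ^+ 2) <= 4.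
Proof.
move=> s0; rewrite expRN mulrC ler_pdivrMr ?expR_gt0//.
have e := expR_ge1Dx (s / 2).
have -> : expR s = expR (s / 2) ^+ 2 by rewrite expr2 -expRD; congr expR; lra.
nra.
Qed.

(** In the plane the Laplacian of [|y|] is [1/|y|]; smoothing adds a
    nonnegative term by concavity of the square root, and making the function
    bounded costs a bounded term. *)
Lemma barrier_Cb2 x :
  Cb2 (barrier \o sqdist x) /\
  forall y, (Num.sqrt (sqdist x y + b^-1))^-1 <=
    laplacian (barrier \o sqdist x) y + 2.
Proof.
pose d : R := sq 0.
have d0 : 0 < d by exact: sq_gt0.
have dsq_le q : 0 <= q -> (sq q)^-1 <= d^-1.
  move=> q0; rewrite lef_pV2 ?posrE ?sq_gt0// ler_wsqrtr//.
  by have := bV_gt0; lra.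
have qle q : 0 <= q -> expR (- sq q) * (1 + q) <= 4.
  move=> q0; apply: le_trans (expRN_decay (sq_gt0 q0)).
  rewrite ler_wpM2l ?expR_ge0// sqK//; have := bV_gt0; lra.
have [] := @Cb2_radial R barrier H1 H2 (1 + 2 * d^-1 + d^-1 ^+ 2 + d^-1 ^+ 3) x.
- exact: dH.
- exact: dH1.
- exact: cH2.
- move=> q q0; apply: le_trans (normr_barrier_le1 _) _.
  by rewrite -!addrA lerDl !addr_ge0 ?exprn_ge0 ?mulr_ge0 ?invr_ge0 ?ltW.
- move=> q q0; have s0 := sq_gt0 q0; have h := qle _ q0; have k := dsq_le _ q0.
  rewrite ger0_norm; last by rewrite divr_ge0 ?expR_ge0// mulr_ge0 ?ltW.
  have e : H1 q * (1 + q) = expR (- sq q) * (1 + q) / 2 * (sq q)^-1.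
    by rewrite /H1; field; rewrite gt_eqF.
  rewrite e.
  have : 0 <= (sq q)^-1 by rewrite invr_ge0 ltW.
  have : 0 <= d^-1 by rewrite invr_ge0 ltW.
  move: h k; move: (expR _ * _) (sq q)^-1 d^-1 => A B D h k D0 B0.
  apply: (@le_trans _ _ (2 * B)); first by nra.
  have : 0 <= D ^+ 2 by rewrite exprn_ge0.
  have : 0 <= D ^+ 3 by rewrite exprn_ge0.
  lra.
- move=> q q0; have s0 := sq_gt0 q0; have h := qle _ q0; have k := dsq_le _ q0.
  rewrite normrN ger0_norm; last first.
    by rewrite mulr_ge0 ?expR_ge0// addr_ge0// invr_ge0 mulr_ge0 ?exprn_ge0// ltW.
  have e : expR (- sq q) * ((4 * sq q ^+ 2)^-1 + (4 * sq q ^+ 3)^-1) * (1 + q) =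
      expR (- sq q) * (1 + q) * (4^-1 * (sq q)^-1 ^+ 2 + 4^-1 * (sq q)^-1 ^+ 3).
    by field; rewrite gt_eqF.
  rewrite e.
  have : 0 <= (sq q)^-1 by rewrite invr_ge0 ltW.
  have : 0 <= d^-1 by rewrite invr_ge0 ltW.
  move: h k; move: (expR _ * _) (sq q)^-1 d^-1 => A B D h k D0 B0.
  have k2 : B ^+ 2 <= D ^+ 2 by rewrite lerXn2r.
  have k3 : B ^+ 3 <= D ^+ 3 by rewrite lerXn2r.
  have : 0 <= B ^+ 2 by rewrite exprn_ge0.
  have : 0 <= B ^+ 3 by rewrite exprn_ge0.
  move: k2 k3; move: (B ^+ 2) (B ^+ 3) (D ^+ 2) (D ^+ 3) => B2 B3 D2 D3 *.
  apply: (@le_trans _ _ (4 * (4^-1 * B2 + 4^-1 * B3))).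
    by rewrite ler_wpM2r//; lra.
  lra.
move=> cb2 lap; split=> // y; rewrite lap.
have q0 := sqdist_ge0 x y; move: (sqdist x y) q0 => q q0.
have s0 := sq_gt0 q0; have sK := sqK q0.
have e1 : expR (- sq q) <= 1 by rewrite -[leRHS]expR0 ler_expR; lra.
have e2 := expR_ge1Dx (- sq q).
have e0 := expR_ge0 (- sq q).
rewrite -/(sq q) /H1 /H2.
have qE : q <= sq q ^+ 2 by rewrite sK; have := bV_gt0; lra.
move: s0 qE e1 e2 e0; move: (sq q) (expR _) => s e s0 qE e1 e2 e0.
have i0 : 0 < s^-1 by rewrite invr_gt0.
have E : 4 * (q * - (e * ((4 * s ^+ 2)^-1 + (4 * s ^+ 3)^-1)) + e / (2 * s)) =
   e * (2 * s^-1 - (q * s^-1 ^+ 2) * (1 + s^-1)).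
  by field; rewrite gt_eqF.
have qi : q * s^-1 ^+ 2 <= 1.
  by rewrite exprVn ler_pdivrMr ?mul1r// exprn_gt0.
rewrite E.
apply: (@le_trans _ _ (e * (s^-1 - 1) + 2)).
  have es : e * s^-1 >= s^-1 - 1.
    have : (1 - s) * s^-1 <= e * s^-1 by rewrite ler_wpM2r// ltW.
    by rewrite mulrBl divff ?gt_eqF// mul1r.
  lra.
rewrite lerD2r ler_wpM2l//; nra.
Qed.

Lemma log_ratioE q : 0 <= q ->
  b * (1 + q) / (1 + b * q) = (1 + q) / (q + b^-1).
Proof.
move=> q0; have b0 : 0 < b by rewrite (lt_trans ltr01).
have h1 : 1 + b * q != 0 by rewrite gt_eqF// ltr_pwDl// mulr_ge0// ltW.
field; rewrite addrC mulrC in h1; rewrite gt_eqF//=.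
Qed.

(** With [z^4 = 1/(q + b^-1)], this is
    [ln (1 + z^4) <= 4 ln (1 + z) <= 4 z]. *)
Lemma log_ratio_le q : 0 <= q ->
  log_ratio b q <= 4 * Num.sqrt (Num.sqrt (q + b^-1))^-1.
Proof.
move=> q0; rewrite /log_ratio log_ratioE//.
have s0 := sq_gt0 q0; have sK := sqK q0.
set z := Num.sqrt _; have z0 : 0 <= z by exact: sqrtr_ge0.
have z2 : z ^+ 2 = (sq q)^-1 by rewrite sqr_sqrtr// invr_ge0 ltW.
have z4 : z ^+ 4 = (q + b^-1)^-1 by rewrite -sK -exprVn -z2 -exprM.
rewrite -ler_expR lnK ?posrE; last first.
  by rewrite divr_gt0//; have := bV_gt0; lra.
have -> : expR (4 * z) = expR z ^+ 4 by rewrite -expRM_natl.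
apply: (@le_trans _ _ ((1 + z) ^+ 4)); last first.
  by rewrite lerXn2r ?nnegrE ?expR_ge0 ?expR_ge1Dx//; lra.
rewrite -z4.
have h : (q + b^-1) * z ^+ 4 = 1.
  by rewrite z4 divff// gt_eqF// ltr_wpDl ?bV_gt0.
have := bV_gt0; have z40 : 0 <= z ^+ 4 by rewrite exprn_ge0.
have : 1 + z ^+ 4 <= (1 + z) ^+ 4.
  have := exprn_ge0 3 z0; have := exprn_ge0 2 z0.
  have -> : (1 + z) ^+ 4 = 1 + z ^+ 4 + (4 * z + 6 * z ^+ 2 + 4 * z ^+ 3) by ring.
  lra.
move: (z ^+ 4) h z40 => Z h Z0; nra.
Qed.

Lemma potential_sqr_le q : 0 <= q ->
  potential b q ^+ 2 <= (Num.sqrt (q + b^-1))^-1.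
Proof.
move=> q0.
have s0 := sq_gt0 q0.
have z2 : Num.sqrt (sq q)^-1 ^+ 2 = (sq q)^-1 by rewrite sqr_sqrtr// invr_ge0 ltW.
rewrite -/(sq q) -z2 lerXn2r ?nnegrE ?sqrtr_ge0 ?potential_ge0//.
apply: le_trans (potential_le b1 q0) _.
have p : 0 < 2 * pi :> R by rewrite mulr_gt0 ?pi_gt0.
rewrite mulrC ler_pdivrMr//; apply: le_trans (log_ratio_le q0) _.
rewrite mulrC ler_wpM2l ?sqrtr_ge0//; have := pi_ge2 R; lra.
Qed.

(** Near its pole, and once [b] is large, the potential is the Green function
    [pi^-1 * ln (1/r)] of the plane up to a bounded error. *)
Lemma potential_log q : 0 < q -> q <= 1 -> q^-1 <= b ->
  `|potential b q - (2 * pi)^-1 * - ln q| <= 1.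
Proof.
move=> q0 q1 qb.
have b0 : 0 < b by rewrite (lt_trans ltr01).
have p : 0 < (2 * pi)^-1 :> R by rewrite invr_gt0 mulr_gt0 ?pi_gt0.
have p4 : (2 * pi)^-1 <= 4^-1 :> R.
  by rewrite lef_pV2 ?posrE ?mulr_gt0 ?pi_gt0//; have := pi_ge2 R; lra.
have up := potential_le b1 (ltW q0).
have lo := potential_ge b1 (ltW q0).
(* [r] is bounded above and away from zero, since [b q >= 1] and [q <= 1]. *)
pose r := q * (b * (1 + q) / (1 + b * q)).
have h1 : 0 < 1 + b * q by rewrite ltr_pwDl// mulr_ge0// ltW.
have bq : 1 <= b * q by rewrite -ler_pdivrMr// div1r.
have r2 : r <= 2.
  by rewrite /r mulrA ler_pdivrMr//; nra.
have r12 : 2^-1 <= r.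
  by rewrite /r mulrA ler_pdivlMr//; nra.
have r0 : 0 < r by lra.
have lE : log_ratio b q = ln r - ln q.
  rewrite /r lnM ?posrE//; first by rewrite addrC addKr.
  by rewrite !mulr_gt0 ?invr_gt0//; lra.
have ln2 : ln (2 : R) <= 1.
  have := @le_ln1Dx R 1; have -> : 1 + 1 = 2 :> R by lra.
  by apply; lra.
have lr : ln r <= 1 by apply: le_trans ln2; rewrite ler_ln ?posrE.
have lr' : -1 <= ln r.
  apply: le_trans (_ : ln (2^-1 : R) <= _); first by rewrite lnV ?posrE//; lra.
  by rewrite ler_ln ?posrE//; lra.
rewrite lE in up lo.
move: p p4 up lo lr lr'; move: (2 * pi)^-1 (ln q) (ln r) (potential b q).
move=> c l s P c0 c4 up lo lr lr'.
rewrite ler_norml; apply/andP; split; nra.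
Qed.

End barrier.

(** * Measurability and duality for finite measures on the plane *)

Section joint_measurability.
Context {R : realType}.

Let grid (n : nat) (s : R) : R := (Num.floor (s * n.+1%:R))%:~R / n.+1%:R.

Let grid_cvg (s : R) : grid n s @[n --> \oo] --> s.
Proof.
apply/cvgrPdist_lt => e e0.
near=> n.
have n0 : 0 < n.+1%:R :> R by rewrite ltr0n.
have /andP[f1 f2] := floor_itv (s * n.+1%:R).
have h : n.+1%:R^-1 < e.
  by near: n; exact: (near_infty_natSinv_lt (PosNum e0)).
have g1 : grid n s <= s by rewrite ler_pdivrMr.
have g2 : s < grid n s + n.+1%:R^-1.
  rewrite -[X in _ + X]mul1r -mulrDl ltr_pdivlMr//.
  by rewrite intrD in f2.
rewrite ger0_norm ?subr_ge0// ltrBlDl (lt_le_trans g2)//.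
by rewrite lerD2l ltW.
Unshelve. all: by end_near. Qed.

(** Sampling [s] on the grid of mesh [1/(n+1)] gives countably many measurable
    rectangles for each [n]; the approximation converges by continuity. *)
Lemma measurable_fun_caratheodory d (T : measurableType d) (Y : R -> T -> R) :
  (forall s, measurable_fun setT (Y s)) ->
  (forall w, continuous (Y ^~ w)) ->
  measurable_fun setT (fun p : R * T => Y p.1 p.2).
Proof.
move=> mY cY.
apply: (@measurable_fun_cvg _ _ _ _ (fun n (p : R * T) => Y (grid n p.1) p.2)).
  move=> n _ A mA; rewrite setTI.
  have -> : (fun p : R * T => Y (grid n p.1) p.2) @^-1` A =
     \bigcup_(k : int) ([set s : R | k%:~R <= s * n.+1%:R < (k + 1)%:~R] `*`
        (Y (k%:~R / n.+1%:R) @^-1` A)).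
    apply/seteqP; split => [[s w] /= h|[s w] [k _] [/= h1 h2]].
      by exists (Num.floor (s * n.+1%:R)) => //; split => //=; exact: floor_itv.
    by rewrite /grid (floor_def h1).
  apply: countable_bigcupT_measurable => // k; apply: measurableX; last first.
    by rewrite -[X in measurable X]setTI; exact: mY.
  have n0 : 0 < n.+1%:R :> R by rewrite ltr0n.
  rewrite (_ : [set _ | _] = `[k%:~R / n.+1%:R, (k + 1)%:~R / n.+1%:R[%classic)//.
  by apply/seteqP; split => s /=; rewrite in_itv/= ler_pdivrMr// ltr_pdivlMr.
move=> [s w] _ /=.
have h : (Y^~ w \o grid^~ s) n @[n --> \oo] --> Y s w.
  by apply: (@continuous_cvg _ _ _ _ _ (grid^~ s) (Y^~ w) s);
    [exact: cY|exact: grid_cvg].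
exact: h.
Qed.

(** The plane carries the product sigma-algebra, for which a continuous function
    is measurable as a Caratheodory function of its two coordinates. *)
Lemma continuous_measurable_plane (f : R * R -> R) :
  continuous f -> measurable_fun setT f.
Proof.
move=> cf.
have : measurable_fun setT (fun p : R * R => (fun s u => f (s, u)) p.1 p.2).
  apply: (@measurable_fun_caratheodory _ _ (fun s u : R => f (s, u))).
    move=> s; apply: continuous_measurable_fun => u.
    apply: (@continuous_comp _ _ _ (fun u => (s, u)) f); last exact: cf.
    by apply: (@cvg_pair _ _ _ _ (nbhs s) (nbhs u)); [exact: cvg_cst|exact: cvg_id].
  move=> u s.
  apply: (@continuous_comp _ _ _ (fun s => (s, u)) f); last exact: cf.
  by apply: (@cvg_pair _ _ _ _ (nbhs s) (nbhs u)); [exact: cvg_id|exact: cvg_cst].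
rewrite (_ : (fun p => _) = f); first exact.
by apply/funext => -[].
Qed.

End joint_measurability.

Section pairing.
Context {R : realType}.
Implicit Types (f g : R * R -> R) (mu : MF R).

Lemma Cb_cst (c : R) : Cb (fun=> c : R).
Proof. by split; [move=> x; exact: cvg_cst|exists `|c|]. Qed.

Lemma CbD f g : Cb f -> Cb g -> Cb (fun x => f x + g x).
Proof.
move=> [cf [K fK]] [cg [L gL]]; split.
  by move=> x; apply: cvgD; [exact: cf|exact: cg].
by exists (K + L) => x; apply: le_trans (ler_normD _ _) _; exact: lerD.
Qed.

Lemma CbM f g : Cb f -> Cb g -> Cb (fun x => f x * g x).
Proof.
move=> [cf [K fK]] [cg [L gL]]; split.
  by move=> x; apply: cvgM; [exact: cf|exact: cg].
by exists (K * L) => x; rewrite normrM ler_pM.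
Qed.

Lemma CbZ (c : R) f : Cb f -> Cb (fun x => c * f x).
Proof. by apply: CbM; exact: Cb_cst. Qed.

Lemma CbB f g : Cb f -> Cb g -> Cb (fun x => f x - g x).
Proof.
move=> Cf Cg; have -> : (fun x => f x - g x) = (fun x => f x + -1 * g x).
  by apply/funext => x; rewrite mulN1r.
exact/CbD/CbZ.
Qed.

Lemma Cb_sqr f : Cb f -> Cb (fun x => f x ^+ 2).
Proof. by move=> Cf; exact: CbM. Qed.

Lemma Cb2_Cb f : Cb2 f -> Cb f.
Proof. by case; case. Qed.

Lemma Cb_sum (s : seq (R * R)) (g : R * R -> R * R -> R) :
  (forall v, v \in s -> Cb (g v)) -> Cb (fun x => \sum_(v <- s) g v x).
Proof.
elim: s => [|v s IH] Cg.
  rewrite (_ : (fun x => _) = fun=> 0); first exact: Cb_cst.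
  by apply/funext => x; rewrite big_nil.
rewrite (_ : (fun x => _) = fun x => g v x + \sum_(v <- s) g v x).
  apply: CbD; first by apply: Cg; rewrite mem_head.
  by apply: IH => w ws; apply: Cg; rewrite inE ws orbT.
by apply/funext => x; rewrite big_cons.
Qed.

Lemma Cb_laplacian f : Cb2 f -> Cb (laplacian f).
Proof.
by move=> [_ Cf]; apply: Cb_sum => v va; have [_ /(_ v va)[]] := Cf v va.
Qed.

Lemma Cb_integrable mu f : Cb f -> mu.-integrable setT (EFin \o f).
Proof.
move=> [cf [K fK]]; apply: measurable_bounded_integrable => //.
- by rewrite ltey_eq fin_num_measure.
- exact: continuous_measurable_plane.
- by exists K; split; rewrite ?num_real// => M KM x _; apply: le_trans (fK x) (ltW KM).
Qed.

Lemma pairing_ge0 mu f : (forall x, 0 <= f x) -> 0 <= pairing mu f.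
Proof. by move=> f0; apply: Rintegral_ge0. Qed.

Lemma pairingD mu f g : Cb f -> Cb g ->
  pairing mu (fun x => f x + g x) = pairing mu f + pairing mu g.
Proof. by move=> Cf Cg; rewrite /pairing RintegralD//; exact: Cb_integrable. Qed.

Lemma pairingZ mu (c : R) f : Cb f ->
  pairing mu (fun x => c * f x) = c * pairing mu f.
Proof. by move=> Cf; rewrite /pairing RintegralZl//; exact: Cb_integrable. Qed.

Lemma le_pairing mu f g : Cb f -> Cb g -> (forall x, f x <= g x) ->
  pairing mu f <= pairing mu g.
Proof.
by move=> Cf Cg fg; apply: le_Rintegral => //; exact: Cb_integrable.
Qed.

Lemma pairing_dirac mu a f : Cb f ->
  (forall A, measurable A -> mu A = \d_a A) -> pairing mu f = f a.
Proof.
move=> [cf _] muE; rewrite /pairing /Rintegral.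
rewrite (eq_measure_integral (\d_a)); last by move=> A mA _; exact: muE.
rewrite integral_dirac ?diracT ?mul1e//.
by apply/measurable_EFinP; exact: continuous_measurable_plane.
Qed.

Lemma continuous_pairing f : Cb f -> continuous (fun mu : MF R => pairing mu f).
Proof.
move=> Cf mu.
pose i : set_type [set f | @Cb R f] := exist _ f (mem_set Cf).
apply: (@continuous_comp _ _ _ (@pairings R) (proj i)).
  exact: initial_continuous.
exact: proj_continuous.
Qed.

Lemma measurable_pairing f : Cb f ->
  measurable_fun setT (fun mu : borelMF R => pairing mu f).
Proof.
move=> Cf; apply: (measurability _ (RGenOpens.measurableE R)).
move=> _ [_ [a [b ->] <-]]; rewrite setTI.
apply: sub_sigma_algebra.
by apply: open_comp; [move=> mu _; exact: continuous_pairing|exact: interval_open].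
Qed.

End pairing.

(** * Occupation integrals of continuous measure-valued processes *)

Section occupation.
Context {R : realType} {d : measure_display} {Omega : measurableType d}.
Variables (P : probability Omega R) (F : R -> set_system Omega).
Variable X : R -> Omega -> MF R.
Hypothesis hF : filtration F.
Hypothesis aX : adapted F (X : R -> Omega -> borelMF R).
Hypothesis cX : continuous_paths X.
Implicit Types (f g : R * R -> R) (s t : R) (w : Omega).
Notation mu := (@lebesgue_measure R).

Lemma continuous_path_pairing f w : Cb f ->
  {within `[0, +oo[, continuous (fun s => pairing (X s w) f)}.
Proof.
move=> Cf s.
apply: (@continuous_comp _ _ _ (X ^~ w : subspace `[0, +oo[ -> MF R)
  (fun m => pairing m f)); first exact: cX.
exact: continuous_pairing.
Qed.

Lemma measurable_pairing_process f t : Cb f -> 0 <= t ->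
  measurable_fun setT (fun w => pairing (X t w) f).
Proof.
move=> Cf t0 _ B mB; rewrite setTI.
have [_ Fm _] := hF; apply: (Fm t t0).
apply: (aX t0 (A := (fun m => pairing m f) @^-1` B)).
by rewrite -[X in measurable X]setTI; exact: measurable_pairing.
Qed.

(* Times are clamped to [[0, +oo[], the region where paths are known to be
   continuous. *)
Let Y f s w : R := pairing (X (Num.max 0 s) w) f.

Let measurable_Y f : Cb f -> measurable_fun setT (fun p : R * Omega => Y f p.1 p.2).
Proof.
move=> Cf; apply: (@measurable_fun_caratheodory _ _ _ (Y f)).
  by move=> s; apply: measurable_pairing_process => //; rewrite le_max lexx.
move=> w s.
have /subspace_continuousP/(_ (Num.max 0 s)) := @continuous_path_pairing f w Cf.
rewrite /= in_itv/= andbT le_max lexx /= => /(_ isT) h.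
have c : {for s, continuous (fun s : R => Num.max 0 s)}.
  by apply: continuous_max; [exact: cvg_cst|exact: cvg_id].
move=> B /h; rewrite /within/= => nB.
apply: (@filterS _ _ (nbhs_filter s) _ _ _ (c _ nB)) => r /=; apply.
by rewrite in_itv/= andbT le_max lexx.
Qed.

Lemma path_integrable f t w : Cb f ->
  mu.-integrable `[0, t] (EFin \o (fun s => pairing (X s w) f)).
Proof.
move=> Cf; apply: continuous_compact_integrable; first exact: segment_compact.
apply: continuous_subspaceW (@continuous_path_pairing f w Cf).
by move=> s /=; rewrite !in_itv/= andbT => /andP[].
Qed.

Lemma time_integral_ge0 f t w : (forall x, 0 <= f x) -> 0 <= time_integral X f t w.
Proof. by move=> f0; apply: Rintegral_ge0 => s _; exact: pairing_ge0. Qed.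

Lemma le_time_integral f g t w : Cb f -> Cb g -> (forall x, f x <= g x) ->
  time_integral X f t w <= time_integral X g t w.
Proof.
move=> Cf Cg fg; apply: le_Rintegral => //.
- exact: path_integrable.
- exact: path_integrable.
- by move=> s _; exact: le_pairing.
Qed.

Lemma time_integralD f g t w : Cb f -> Cb g ->
  time_integral X (fun x => f x + g x) t w =
  time_integral X f t w + time_integral X g t w.
Proof.
move=> Cf Cg; rewrite /time_integral -RintegralD//; [|exact: path_integrable..].
by apply: eq_Rintegral => s _; exact: pairingD.
Qed.

Lemma time_integralZ (c : R) f t w : Cb f ->
  time_integral X (fun x => c * f x) t w = c * time_integral X f t w.
Proof.
move=> Cf; rewrite /time_integral -RintegralZl//; last exact: path_integrable.
by apply: eq_Rintegral => s _; exact: pairingZ.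
Qed.

Lemma time_integralB f g t w : Cb f -> Cb g ->
  time_integral X (fun x => f x - g x) t w =
  time_integral X f t w - time_integral X g t w.
Proof.
move=> Cf Cg.
rewrite (_ : (fun x => _) = fun x => f x + -1 * g x); last first.
  by apply/funext => x; rewrite mulN1r.
rewrite time_integralD//; last exact: CbZ.
by rewrite time_integralZ// mulN1r.
Qed.

Let patched f t (p : R * Omega) : \bar R := (\1_`[0, t] p.1 * Y f p.1 p.2)%:E.

Let measurable_patched f t : Cb f -> measurable_fun setT (patched f t).
Proof.
move=> Cf; apply/measurable_EFinP; apply: measurable_funM; last exact: measurable_Y.
by apply: measurableT_comp => //; exact: measurable_indic.
Qed.

Let patched_ge0 f t p : (forall x, 0 <= f x) -> (0 <= patched f t p)%E.
Proof. by move=> f0; rewrite lee_fin mulr_ge0// pairing_ge0. Qed.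

Let patchedE f t s w : patched f t (s, w) =
  ((fun s => (pairing (X s w) f)%:E) \_ `[0, t]) s.
Proof.
rewrite /patched /patch indicE /=; case: ifPn; rewrite ?mul0r// inE/= in_itv/=.
by move=> /andP[s0 _]; rewrite mul1r /Y max_r.
Qed.

Lemma EFin_time_integral f t w : Cb f ->
  (time_integral X f t w)%:E = (\int[mu]_(s in `[0%R, t]) (pairing (X s w) f)%:E)%E.
Proof.
move=> Cf; rewrite /time_integral /Rintegral fineK//.
by apply: integrable_fin_num => //; exact: path_integrable.
Qed.

Let time_integralE f t w : Cb f ->
  (time_integral X f t w)%:E = (\int[mu]_s patched f t (s, w))%E.
Proof.
move=> Cf; rewrite EFin_time_integral// integral_mkcond.
by apply: eq_integral => s _; rewrite patchedE.
Qed.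

Lemma measurable_time_integral f t : Cb f -> (forall x, 0 <= f x) ->
  measurable_fun setT (time_integral X f t).
Proof.
move=> Cf f0; apply/measurable_EFinP.
rewrite (_ : EFin \o _ = fubini_G mu (patched f t)); last first.
  by apply/funext => w /=; rewrite time_integralE.
apply: measurable_fun_fubini_tonelli_G => //; first exact: measurable_patched.
by move=> p; exact: patched_ge0.
Qed.

(** Tonelli's theorem; joint measurability comes from path continuity. *)
Lemma expectation_time_integral f t : Cb f -> (forall x, 0 <= f x) ->
  (\int[P]_w (time_integral X f t w)%:E =
   \int[mu]_(s in `[0%R, t]) \int[P]_w (pairing (X s w) f)%:E)%E.
Proof.
move=> Cf f0.
transitivity (\int[P]_w \int[mu]_s patched f t (s, w))%E.
  by apply: eq_integral => w _; exact: time_integralE.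
have <- := @fubini_tonelli _ _ _ _ R mu P (patched f t)
  (measurable_patched t Cf) (fun p => patched_ge0 t p f0).
rewrite [RHS]integral_mkcond; apply: eq_integral => s _.
rewrite /patch; case: ifPn => st.
  by apply: eq_integral => w _; rewrite patchedE /patch st.
by rewrite integral0_eq// => w _; rewrite patchedE /patch (negbTE st).
Qed.

Lemma measurable_mean_pairing f t : Cb f -> (forall x, 0 <= f x) ->
  measurable_fun `[0, t] (fun s => \int[P]_w (pairing (X s w) f)%:E)%E.
Proof.
move=> Cf f0.
apply: (eq_measurable_fun (fun s => \int[P]_w (Y f s w)%:E)%E).
  move=> s; rewrite inE/= in_itv/= => /andP[s0 _].
  by apply: eq_integral => w _; rewrite /Y max_r.
apply: measurable_funTS.
apply: (@measurable_fun_fubini_tonelli_F _ _ _ _ _ P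
  (fun p : R * Omega => (Y f p.1 p.2)%:E)).
  by apply/measurable_EFinP; exact: measurable_Y.
by move=> p; rewrite lee_fin pairing_ge0.
Qed.

Lemma time_integral_homo f s t w : Cb f -> (forall x, 0 <= f x) -> s <= t ->
  time_integral X f s w <= time_integral X f t w.
Proof.
move=> Cf f0 st; rewrite -lee_fin !EFin_time_integral//.
apply: ge0_subset_integral => //.
- by have /integrableP[] := path_integrable t w Cf.
- by move=> r _; rewrite lee_fin pairing_ge0.
- by move=> r /=; rewrite !in_itv/= => /andP[-> /= /le_trans]; apply.
Qed.

End occupation.

(** * Almost sure Fatou lemma and second moments of martingales *)

Section almost_sure_fatou.
Context {R : realType} {d : measure_display} {T : measurableType d}.
Variable m : {measure set T -> \bar R}.

Lemma limn_einf_le (u : (\bar R)^nat) (c : \bar R) :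
  (forall n, (u n <= c)%E) -> (limn_einf u <= c)%E.
Proof.
move=> uc; rewrite limn_einf_lim; apply: lime_le; first exact: is_cvg_einfs.
apply: nearW => n; apply: le_trans (uc n).
by apply: ereal_inf_lbound; exists n => /=.
Qed.

Lemma fatou_ae (f_ : nat -> T -> R) (f : T -> R) (c : \bar R) :
  (forall n, measurable_fun setT (f_ n)) -> measurable_fun setT f ->
  (forall n w, 0 <= f_ n w) -> (forall w, 0 <= f w) ->
  {ae m, forall w, f_ n w @[n --> \oo] --> f w} ->
  (forall n, \int[m]_w (f_ n w)%:E <= c)%E -> (\int[m]_w (f w)%:E <= c)%E.
Proof.
move=> mf_ mf f_0 f0 cvgf fc.
have mf_E n : measurable_fun setT (EFin \o f_ n) by exact/measurable_EFinP.
have mli : measurable_fun setT (fun w => limn_einf (fun n => (f_ n w)%:E)).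
  rewrite (_ : (fun w => _) = fun w => (- limn_esup (fun n => - (f_ n w)%:E))%E).
    apply: measurableT_comp => //; apply: measurable_fun_limn_esup => n.
    by apply: measurableT_comp => //; exact: mf_E.
  apply/funext => w; rewrite -limn_einfN; congr limn_einf.
  by apply/funext => n /=; rewrite opprK.
have li0 w : (0 <= limn_einf (fun n => (f_ n w)%:E))%E.
  rewrite limn_einf_lim; apply: lime_ge; first exact: is_cvg_einfs.
  apply: nearW => n; apply: le_ereal_inf_tmp => _ [k /= _ <-].
  by rewrite lee_fin.
rewrite (@ge0_ae_eq_integral _ _ _ _ _ _
  (fun w => limn_einf (fun n => (f_ n w)%:E)))//.
- apply: le_trans (fatou _ _ mf_E _) _ => //.
    by move=> n w _; rewrite lee_fin.
  exact: limn_einf_le.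
- exact/measurable_EFinP.
- by move=> w _; rewrite lee_fin.
- apply: filterS cvgf => w cw _.
  have /cvg_limn_einf_sup[-> _]// : (f_ n w)%:E @[n --> \oo] --> (f w)%:E.
  apply: cvg_EFin; last exact: cw.
  exact: nearW.
Qed.

End almost_sure_fatou.

Section martingales.
Context {R : realType} {d : measure_display} {Omega : measurableType d}.
Variables (P : probability Omega R) (F : R -> set_system Omega).
Hypothesis hF : filtration F.
Implicit Types (M A : R -> Omega -> R) (t : R).

Lemma martingale_mean M t : martingale P F M -> 0 <= t ->
  (\int[P]_w (M t w)%:E = \int[P]_w (M 0 w)%:E)%E.
Proof.
move=> [_ _ /(_ 0 t (lexx _)) H] t0; have [_ _ /(_ setT) ->//] := H t0.
have [/(_ 0 (lexx _)) [F0 FC _] _ _] := hF.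
by rewrite -(setD0 setT); exact: FC.
Qed.

Lemma martingale_mean0 M t : martingale P F M ->
  {ae P, forall w, M 0 w = 0} -> 0 <= t -> (\int[P]_w (M t w)%:E = 0)%E.
Proof.
move=> mM M0 t0; rewrite martingale_mean//.
rewrite (ae_eq_integral (cst 0%E))//; first exact: integral0.
- have [_ iM _] := mM.
  by have /integrableP[] := iM 0 (lexx _).
- by apply: filterS M0 => w /= -> _.
Qed.

(** One half of the Ito isometry. Along a localising sequence [M^2 - A] is a
    centred martingale, so [E M_s^2 = E A_s <= E A_t] at the stopped times [s];
    Fatou removes the localisation. *)
Lemma second_moment_le M A t : 0 <= t -> measurable_fun setT (M t) ->
  {ae P, forall w, M 0 w = 0} -> quadratic_variation P F M A ->
  (forall w, 0 <= A t w) -> P.-integrable setT (EFin \o A t) ->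
  (\int[P]_w (M t w ^+ 2)%:E <= \int[P]_w (A t w)%:E)%E.
Proof.
move=> t0 mM M0 [_ _ A0 homoA [_ _ [tau [st_tau tau_oo mart]]]] At0 iA.
set N := fun t w => M t w ^+ 2 - A t w in mart.
pose S n w := stopped (tau n) (fun t w => N t w - N 0 w) t w.
have mS n : P.-integrable setT (EFin \o S n) by have [_ /(_ t t0)] := mart n.
have ES n : (\int[P]_w (S n w)%:E = 0)%E.
  have [tau0 _] := st_tau n.
  rewrite (martingale_mean (mart n) t0) integral0_eq// => w _.
  by rewrite /stopped (min_idPl (tau0 w)) /= subrr.
have mSr n : measurable_fun setT (S n).
  by apply/measurable_EFinP; have /integrableP[] := mS n.
have mAr : measurable_fun setT (A t).
  by apply/measurable_EFinP; have /integrableP[] := iA.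
have bound n : (\int[P]_w (`|S n w + A t w|)%:E <= \int[P]_w (A t w)%:E)%E.
  rewrite (_ : (\int[P]_w (A t w)%:E)%E = (\int[P]_w (S n w + A t w)%:E)%E).
    rewrite le_eqVlt; apply/orP; left; apply/eqP.
    apply: ae_eq_integral => //.
    - by apply/measurable_EFinP; apply: measurableT_comp => //; exact: measurable_funD.
    - by apply/measurable_EFinP; exact: measurable_funD.
    apply: filterS2 M0 A0 => w M0w A0w _; congr EFin; rewrite ger0_norm//.
    rewrite /S /stopped /N M0w A0w expr0n/= subr0 subr0.
    have [tau0 _] := st_tau n.
    (* [s] is the stopped time [min (t, tau_n)]. *)
    set s := fine _; have s0t : 0 <= s <= t.
      rewrite /s; have := tau0 w; case: (tau n w) => [r|//|//] /= r0.
        rewrite -EFin_min /= le_min ge_min t0 lexx.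
        by rewrite lee_fin in r0; rewrite r0.
      by rewrite miney /= t0 lexx.
    case/andP: s0t => s0 s_t.
    have As : A s w <= A t w.
      by apply: homoA => //; rewrite in_itv/= andbT.
    by have := sqr_ge0 (M s w); lra.
  under [RHS]eq_integral do rewrite EFinD.
  rewrite (@integralD_EFin _ _ _ P setT _ (S n) (A t))//.
  by rewrite ES add0e.
apply: (@fatou_ae _ _ _ P (fun n w => `|S n w + A t w|) (fun w => M t w ^+ 2)).
- by move=> n; apply: measurableT_comp => //; exact: measurable_funD.
- exact: measurable_funX.
- by move=> n w.
- by move=> w; exact: sqr_ge0.
- apply: filterS3 M0 A0 tau_oo => w M0w A0w [_ tauw].
  apply: cvg_near_cst.
  have /cvgeyPge/(_ t) tn := tauw.
  apply: filterS tn => n tn.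
  rewrite /S /stopped (min_idPl tn) /= /N M0w A0w expr0n/= subr0 subr0.
  by rewrite subrK ger0_norm// sqr_ge0.
- exact: bound.
Qed.

End martingales.

(** * Calculus of means *)

Section means.
Context {R : realType} {d : measure_display} {T : measurableType d}.
Variable P : probability T R.
Implicit Types (f g : T -> R) (c : R).

(** Bundling integrability with the value of the expectation lets the means of
    linear combinations be computed without side conditions. *)
Definition has_mean f c : Prop :=
  P.-integrable setT (EFin \o f) /\ (\int[P]_w (f w)%:E = c%:E)%E.

Lemma has_mean_measurable f c : has_mean f c -> measurable_fun setT f.
Proof. by move=> [/integrableP[mf _] _]; exact/measurable_EFinP. Qed.

Lemma has_mean_ex f : P.-integrable setT (EFin \o f) -> exists c, has_mean f c.
Proof.
move=> fi; exists (fine (\int[P]_w (f w)%:E)%E); split=> //.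
by rewrite fineK//; exact: integrable_fin_num.
Qed.

Lemma has_mean_cst c : has_mean (fun=> c) c.
Proof.
split; first exact: finite_measure_integrable_cst.
by rewrite integral_cst// -[RHS]mule1; congr (_ * _)%E; exact: probability_setT.
Qed.

Lemma has_meanD f g a b :
  has_mean f a -> has_mean g b -> has_mean (fun w => f w + g w) (a + b).
Proof.
move=> [fi fa] [gi gb]; split.
  rewrite (_ : EFin \o _ = (EFin \o f) \+ (EFin \o g))%E//.
  exact: integrableD.
under eq_integral do rewrite EFinD.
by rewrite (@integralD_EFin _ _ _ P setT _ f g)// EFinD; congr (_ + _)%E.
Qed.

Lemma has_meanZ k f a : has_mean f a -> has_mean (fun w => k * f w) (k * a).
Proof.
move=> [fi fa]; split.
  rewrite (_ : EFin \o _ = (fun w => k%:E * (EFin \o f) w)%E)//.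
  exact: integrableZl.
under eq_integral do rewrite EFinM.
by rewrite (@integralZl _ _ _ P setT _ (EFin \o f))// EFinM; congr (_ * _)%E.
Qed.

Lemma has_mean_ae f g c : has_mean f c -> measurable_fun setT g ->
  {ae P, forall w, g w = f w} -> has_mean g c.
Proof.
move=> hf mg gf; have mf := has_mean_measurable hf; have [fi fc] := hf.
have E : ae_eq P setT (EFin \o f) (EFin \o g).
  by apply: filterS gf => w gfw _ /=; rewrite gfw.
have mgE : measurable_fun setT (EFin \o g) by exact/measurable_EFinP.
have mfE : measurable_fun setT (EFin \o f) by exact/measurable_EFinP.
split; last first.
  by rewrite -fc; apply: ae_eq_integral => //; exact/ae_eq_sym.
apply/integrableP; split => //.
have /integrableP[_] := fi; congr (_ < _)%E; apply: ae_eq_integral => //.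
- exact: measurableT_comp.
- exact: measurableT_comp.
- by apply: filterS E => w h /h <-.
Qed.

Lemma has_mean_le f g c : measurable_fun setT f -> (forall w, 0 <= f w) ->
  {ae P, forall w, f w <= g w} -> has_mean g c ->
  exists2 a, has_mean f a & a <= c.
Proof.
move=> mf f0 fg hg; have mg := has_mean_measurable hg; have [gi gc] := hg.
have le : (\int[P]_w (f w)%:E <= c%:E)%E.
  rewrite -gc [leRHS](ae_eq_integral (fun w => `|(g w)%:E|)%E)//; last 3 first.
  - exact/measurable_EFinP.
  - by apply: measurableT_comp => //; exact/measurable_EFinP.
  - apply: filterS fg => w fgw _ /=; rewrite ger0_norm//.
    exact: le_trans (f0 w) fgw.
  apply: ae_ge0_le_integral => //.
  - by move=> w _; rewrite lee_fin.
  - exact/measurable_EFinP.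
  - by apply: measurableT_comp => //; exact/measurable_EFinP.
  - apply: filterS fg => w fgw _ /=; rewrite lee_fin.
    by rewrite (le_trans fgw)// ler_norm.
have fi : P.-integrable setT (EFin \o f).
  apply/integrableP; split; first exact/measurable_EFinP.
  under eq_integral do rewrite /= ger0_norm//.
  exact: le_lt_trans le (ltry _).
have [a fa] := has_mean_ex fi; exists a => //.
by rewrite -lee_fin; have [_ <-] := fa.
Qed.

Lemma has_mean_mono f g a c : has_mean f a -> has_mean g c ->
  {ae P, forall w, f w <= g w} -> a <= c.
Proof.
move=> hf hg fg.
have h := has_meanD hg (has_meanZ (-1) hf).
have m0 : measurable_fun setT (fun _ : T => 0 : R) by exact: measurable_cst.
have le0 : {ae P, forall w, 0 <= g w + -1 * f w}.
  by apply: filterS fg => w; lra.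
have [b [_ hb] bc] := has_mean_le m0 (fun=> lexx 0) le0 h.
have [_ h0] := has_mean_cst 0.
by move: bc; rewrite -lee_fin -hb h0 lee_fin; lra.
Qed.

End means.

(** * Moment estimates for super-Brownian motion *)

Lemma normr_tanaka_le (R : realDomainType) (S T p M l q : R) :
  0 <= S -> S <= T -> 0 <= p -> `|M| <= 1 + M ^+ 2 -> `|q - l| <= 1 ->
  `|S - (p - q - M) - l| <= T + p + 2 + M ^+ 2.
Proof.
rewrite !ler_norml => S0 ST p0 /andP[m1 m2] /andP[l1 l2].
by apply/andP; split; lra.
Qed.

Lemma normr_le1Dsqr (R : realDomainType) (a : R) : `|a| <= 1 + a ^+ 2.
Proof.
rewrite -(real_normK (num_real a)).
by have := sqr_ge0 (`|a| - 1); have := normr_ge0 a; nra.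
Qed.

Lemma integral_cst_segment (R : realType) (c t : R) : 0 <= t ->
  (\int[lebesgue_measure]_(s in `[0%R, t]) c%:E = (c * t)%:E)%E.
Proof.
move=> t0; rewrite integral_cst//= lebesgue_measure_itv/= lte_fin EFinM.
congr (_ * _)%E.
by case: ltgtP t0 => // [_|<-]; rewrite ?EFinN ?sube0.
Qed.

Section super_brownian_motion_from_a_point.
Context {R : realType} {d : measure_display} {Omega : measurableType d}.
Variables (P : probability Omega R) (F : R -> set_system Omega).
Variable X : R -> Omega -> MF R.
Hypothesis hX : super_brownian_motion P F (\d_(0 : (R * R)%type)) X.
Implicit Types (f g : R * R -> R) (s t b : R) (w : Omega) (x : R * R).

Let hF : filtration F. Proof. by have [[]] := hX. Qed.
Let aX : adapted F (X : R -> Omega -> borelMF R). Proof. by have [[]] := hX. Qed.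
Let cX : continuous_paths X. Proof. by have [] := hX. Qed.

Lemma martingale_decomposition f : Cb2 f ->
  exists M : R -> Omega -> R,
  [/\ {ae P, forall w, forall t, 0 <= t -> pairing (X t w) f =
         f 0 + M t w + time_integral X (fun x => laplacian f x / 2) t w},
      martingale P F M, {ae P, forall w, M 0 w = 0} &
      quadratic_variation P F M (time_integral X (fun x => f x ^+ 2))].
Proof.
move=> Cf; have [_ _ _ X0 /(_ f Cf) [M [dec mM cM M0 qM]]] := hX.
exists M; split=> //; apply: filterS2 dec X0 => w dw X0w t t0.
rewrite dw// (@pairing_dirac _ (X 0 w) 0)//; exact: Cb2_Cb.
Qed.

Let martingale_has_mean0 (M : R -> Omega -> R) t : martingale P F M ->
  {ae P, forall w, M 0 w = 0} -> 0 <= t -> has_mean P (M t) 0.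
Proof.
move=> mM M0 t0; split; first by have [_ /(_ t t0)] := mM.
by rewrite (martingale_mean0 hF mM M0 t0).
Qed.

Let measurable_pairing_at f t : Cb f -> 0 <= t ->
  measurable_fun setT (fun w => pairing (X t w) f).
Proof. exact: (measurable_pairing_process hF aX). Qed.

(** The constant [1] is harmonic, so the total mass is a martingale. *)
Lemma mean_mass t : 0 <= t -> has_mean P (fun w => pairing (X t w) (fun=> 1)) 1.
Proof.
move=> t0.
have [] := @Cb2_radial R (fun=> 1) (fun=> 0) (fun=> 0) 1 0.
- by move=> q _; exact: cvg_cst.
- by move=> q _; rewrite normr1.
- by move=> q _; rewrite normr0 mul0r.
- by move=> q _; rewrite normr0 mul0r.
move=> C1 lap1; have [M [dec mM M0 _]] := martingale_decomposition C1.
have h := has_meanD (has_mean_cst P 1) (martingale_has_mean0 mM M0 t0).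
rewrite addr0 in h; apply: (has_mean_ae h).
  by apply: measurable_pairing_at => //; exact: Cb_cst.
apply: filterS dec => w /(_ t t0) -> /=.
rewrite (_ : (fun x => _) = fun x => 0 * 1); last first.
  by apply/funext => x; rewrite lap1 !mulr0 addr0 mulr0 !mul0r.
by rewrite time_integralZ ?mul0r ?addr0//; exact: Cb_cst.
Qed.

Lemma mean_pairing f t : Cb f -> 0 <= t -> (forall x, 0 <= f x) ->
  exists a, has_mean P (fun w => pairing (X t w) f) a.
Proof.
move=> Cf t0 f0; have [_ [K fK]] := Cf.
have [|a ha _] := has_mean_le (measurable_pairing_at Cf t0)
  (fun w => pairing_ge0 (X t w) f0) _ (has_meanZ K (mean_mass t0)); last by exists a.
apply: aeW => w; rewrite -pairingZ; last exact: Cb_cst.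
apply: le_pairing => //; first exact/CbZ/Cb_cst.
by move=> x; rewrite mulr1 (le_trans _ (fK x))// ler_norm.
Qed.

Lemma mean_total_occupation t : 0 <= t ->
  has_mean P (time_integral X (fun=> 1) t) t.
Proof.
move=> t0.
have mT : measurable_fun setT (time_integral X (fun=> 1) t).
  by apply: (measurable_time_integral hF aX cX) => //; exact: Cb_cst.
have E : (\int[P]_w (time_integral X (fun=> 1) t w)%:E = t%:E)%E.
  rewrite (expectation_time_integral P hF aX cX) //; last exact: Cb_cst.
  rewrite (eq_integral (fun=> 1%:E)).
    by rewrite integral_cst_segment// mul1r.
  by move=> s; rewrite inE/= in_itv/= => /andP[s0 _]; have [_ ->] := mean_mass s0.
split=> //; apply/integrableP; split; first exact/measurable_EFinP.
under eq_integral do rewrite /= ger0_norm ?time_integral_ge0//.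
by rewrite E ltry.
Qed.

Section potential_estimates.
Variables (b : R) (x : R * R).
Hypothesis b1 : 1 < b.

Let phi := potential b \o sqdist x.
Let C2phi : Cb2 phi := (potential_Cb2 b1 x).1.
Let Cphi : Cb phi := Cb2_Cb C2phi.
Let phi_ge0 y : 0 <= phi y. Proof. exact: potential_ge0. Qed.
Let lap y : R := laplacian phi y / 2.

Let Clap : Cb lap.
Proof.
have := CbZ 2^-1 (Cb_laplacian C2phi); congr Cb.
by apply/funext => y; rewrite mulrC.
Qed.

Let source y : R := pi^-1 * expR (- sqdist x y).

Let source_ge0 y : 0 <= source y.
Proof. by rewrite mulr_ge0 ?expR_ge0// invr_ge0 pi_ge0. Qed.

Let source_le1 y : source y <= 1.
Proof.
rewrite mulr_ile1 ?expR_ge0 ?invr_ge0 ?pi_ge0//.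
  by rewrite invf_le1 ?pi_gt0//; have := @pi_ge2 R; lra.
by rewrite -[leRHS]expR0 ler_expR oppr_le0 sqdist_ge0.
Qed.

Let lapE y : lap y = source y - heat_kernel (2 * b)^-1 (y - x).
Proof. exact: (potential_Cb2 b1 x).2. Qed.

Let heat_ge0 y : 0 <= heat_kernel (2 * b)^-1 (y - x).
Proof.
have b0 : 0 <= 2 * b by have := b1; lra.
by rewrite mulr_ge0 ?expR_ge0// invr_ge0 !mulr_ge0 ?invr_ge0 ?pi_ge0.
Qed.

Let Cheat : Cb (fun y => heat_kernel (2 * b)^-1 (y - x)).
Proof.
have [cs bs] : Cb source.
  split; last by exists 1 => y; rewrite ger0_norm.
  move=> y; apply: cvgM; first exact: cvg_cst.
  apply: continuous_comp; last exact: continuous_expR.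
  by apply: cvgN; exact: continuous_sqdist.
have := CbB (conj cs bs) Clap; congr Cb.
by apply/funext => y; rewrite lapE opprB addrC subrK.
Qed.

Let Csource : Cb source.
Proof.
have := CbD Clap Cheat; congr Cb.
by apply/funext => y; rewrite lapE subrK.
Qed.

(** The martingale problem for the bounded barrier [h] bounds the mean
    occupation integral of [Laplacian h / 2], and [phi^2 <= Laplacian h + 2]. *)
Lemma mean_occupation_potential_sqr t : 0 <= t ->
  exists2 a, has_mean P (time_integral X (fun y => phi y ^+ 2) t) a &
    a <= 4 + 2 * t.
Proof.
move=> t0; have [C2h hlap] := barrier_Cb2 b1 x.
set h := barrier b \o sqdist x in C2h hlap.
have Ch := Cb2_Cb C2h.
have Clh : Cb (fun y => laplacian h y / 2).
  have := CbZ 2^-1 (Cb_laplacian C2h); congr Cb.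
  by apply/funext => y; rewrite mulrC.
have [M [dec mM M0 _]] := martingale_decomposition C2h.
have hM := martingale_has_mean0 mM M0 t0.
have C1 : Cb (fun=> 1 : R) := Cb_cst 1.
have hG := has_meanD (has_meanZ 2 (has_meanD (has_meanD (mean_mass t0)
   (has_mean_cst P 1)) (has_meanZ (-1) hM)))
   (has_meanZ 2 (mean_total_occupation t0)).
rewrite (_ : 4 + 2 * t = 2 * (1 + 1 + -1 * 0) + 2 * t); last by lra.
apply: has_mean_le hG.
- by apply: (measurable_time_integral hF aX cX); [exact: Cb_sqr|move=> y; exact: sqr_ge0].
- by move=> w; apply: time_integral_ge0 => y; exact: sqr_ge0.
apply: filterS dec => w /(_ t t0) dw.
have : time_integral X (fun y => phi y ^+ 2) t w <=
    time_integral X (fun y => 2 * (laplacian h y / 2) + 2 * 1) t w.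
  apply: (le_time_integral cX); first exact: Cb_sqr.
    by apply: CbD; apply: CbZ.
  move=> y; apply: le_trans (potential_sqr_le b1 (sqdist_ge0 x y)) _.
  by apply: le_trans (hlap y) _; lra.
rewrite (time_integralD cX); [|exact: CbZ..].
rewrite !(time_integralZ cX)//.
have h0 : - 1 <= h 0 by have := normr_barrier_le1 b (sqdist x 0); rewrite ler_norml => /andP[].
have Xh : pairing (X t w) h <= pairing (X t w) (fun=> 1).
  apply: le_pairing => // y.
  by have := normr_barrier_le1 b (sqdist x y); rewrite ler_norml => /andP[].
have arith (o a c xh x1 z m : R) : xh = z + m + a -> -1 <= z -> xh <= x1 ->
  o <= 2 * a + 2 * c -> o <= 2 * (x1 + 1 + -1 * m) + 2 * c by lra.
exact: arith dw h0 Xh.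
Qed.

Lemma mean_occupation_potential t : 0 <= t ->
  exists2 a, has_mean P (time_integral X phi t) a & a <= 4 + 3 * t.
Proof.
move=> t0; have [c hc c_le] := mean_occupation_potential_sqr t0.
have C1 : Cb (fun=> 1 : R) := Cb_cst 1.
have [||a ha a_le] := has_mean_le (measurable_time_integral hF aX cX t Cphi phi_ge0)
  _ _ (has_meanD (mean_total_occupation t0) hc).
- by move=> w; exact: time_integral_ge0.
- apply: aeW => w; have <- := time_integralD cX t w C1 (Cb_sqr Cphi).
  apply: (le_time_integral cX) => //; first by apply: CbD => //; exact: Cb_sqr.
  by move=> y; have := sqr_ge0 (phi y - 1); have := sqr_ge0 (phi y); nra.
- by exists a => //; lra.
Qed.

(** The half Laplacian of [phi] is at most [1] and the total mass has mean [1],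
    so [E X_s(phi)] cannot grow at a rate larger than [1]. *)
Lemma mean_potential_almost_decreasing s t a c : 0 <= s -> s <= t ->
  has_mean P (fun w => pairing (X t w) phi) a ->
  has_mean P (fun w => pairing (X s w) phi) c -> a <= c + t.
Proof.
move=> s0 st ha hc; have t0 := le_trans s0 st.
have [M [dec mM M0 _]] := martingale_decomposition C2phi.
have C1 : Cb (fun=> 1 : R) := Cb_cst 1.
have hG := has_meanD (has_meanD hc (has_meanD (martingale_has_mean0 mM M0 t0)
  (has_meanZ (-1) (martingale_has_mean0 mM M0 s0)))) (mean_total_occupation t0).
rewrite (_ : c + t = c + (0 + -1 * 0) + t); last by lra.
apply: (has_mean_mono ha hG).
apply: filterS dec => w dw; rewrite (dw s s0) (dw t t0).
have h1 : time_integral X (fun y => 1 - lap y) s w <=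
    time_integral X (fun y => 1 - lap y) t w.
  apply: (time_integral_homo cX) => //; first exact: CbB.
  by move=> y; rewrite lapE; have := source_le1 y; have := heat_ge0 y; lra.
rewrite !(time_integralB cX)// in h1.
have h2 : 0 <= time_integral X (fun=> 1) s w by exact: time_integral_ge0.
have arith (z m m' u u' v v' : R) : u - v <= u' - v' -> 0 <= u ->
  z + m' + v' <= z + m + v + (m' + -1 * m) + u'.
  by clear dw h1 h2; lra.
exact: arith h1 h2.
Qed.

(** Averaging the almost monotone function [s |-> E X_s(phi)] over [[0, t]]
    bounds its last value by the occupation integral. *)
Lemma mean_potential t a : 0 <= t ->
  has_mean P (fun w => pairing (X t w) phi) a -> t * a <= 4 + 3 * t + t ^+ 2.
Proof.
move=> t0 ha; have [c hc c_le] := mean_occupation_potential t0.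
suff : a * t - t ^+ 2 <= c by lra.
(* Only when [a > t] is the lower bound [a - t] for [E X_s(phi)] nonnegative,
   as monotonicity of nonnegative integrals requires. *)
have [a_t|t_a] := leP a t.
  apply: le_trans (_ : 0 <= _); first by rewrite expr2 -mulrBl; nra.
  apply: (has_mean_mono (has_mean_cst P 0) hc); apply: aeW => w.
  exact: time_integral_ge0.
rewrite -lee_fin; have [_ <-] := hc.
rewrite (expectation_time_integral P hF aX cX)//.
apply: (@le_trans _ _ (\int[lebesgue_measure]_(s in `[0%R, t]) (a - t)%:E)%E).
  by rewrite integral_cst_segment// lee_fin; lra.
apply: ge0_le_integral => //.
- by move=> s _; rewrite lee_fin; lra.
- exact: (measurable_mean_pairing P hF aX cX).
move=> s /=; rewrite in_itv/= => /andP[s0 st].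
have [e he] := mean_pairing Cphi s0 phi_ge0.
have [_ ->] := he; rewrite lee_fin.
by have := mean_potential_almost_decreasing s0 st ha he; lra.
Qed.

(** Tanaka's formula for the mollified local time: [phi (0)] carries the
    logarithmic divergence, and the three other terms have bounded means. *)
Lemma mean_heat_occupation t : 0 < t -> 0 < sqdist x 0 -> sqdist x 0 <= 1 ->
  (sqdist x 0)^-1 <= b ->
  exists2 a, has_mean P (fun w => `|time_integral X
      (fun y => heat_kernel (2 * b)^-1 (y - x)) t w
      - (2 * pi)^-1 * - ln (sqdist x 0)|) a &
    a <= 10 + 4 * t + 4 / t.
Proof.
move=> t0 q0 q1 qb; have t0' := ltW t0.
have [M [dec mM M0 qM]] := martingale_decomposition C2phi.
have C1 : Cb (fun=> 1 : R) := Cb_cst 1.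
have [m hm] := mean_pairing Cphi t0' phi_ge0.
have m_le : m <= 4 / t + 3 + t.
  have := mean_potential t0' hm.
  have -> : 4 / t + 3 + t = (4 + 3 * t + t ^+ 2) / t by field; rewrite gt_eqF.
  by rewrite ler_pdivlMr// mulrC.
have [a ha a_le] := mean_occupation_potential_sqr t0'.
have mMt : measurable_fun setT (M t).
  exact: has_mean_measurable (martingale_has_mean0 mM M0 t0').
have M2 : exists2 k, has_mean P (fun w => M t w ^+ 2) k & k <= 4 + 2 * t.
  have le2 := second_moment_le hF t0' mMt M0 qM
    (fun w => time_integral_ge0 X t w (fun y => sqr_ge0 (phi y))) ha.1.
  have fi : P.-integrable setT (EFin \o (fun w => M t w ^+ 2)).
    apply/integrableP; split; first by apply/measurable_EFinP; exact: measurable_funX.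
    under eq_integral do rewrite /= ger0_norm ?sqr_ge0//.
    by apply: le_lt_trans le2 _; rewrite ha.2 ltry.
  have [k hk] := has_mean_ex fi; exists k => //.
  by apply: le_trans a_le; move: le2; rewrite hk.2 ha.2 lee_fin.
have [k hk k_le] := M2.
have hG := has_meanD (has_meanD (has_meanD (mean_total_occupation t0') hm)
  (has_mean_cst P 2)) hk.
set f := (X in has_mean P X).
suff [e he e_le] : exists2 e, has_mean P f e & e <= t + m + 2 + k.
  by exists e => //; lra.
apply: has_mean_le hG.
- apply: measurableT_comp => //; apply: measurable_funB => //.
  exact: (measurable_time_integral hF aX cX).
- by move=> w; exact: normr_ge0.
apply: filterS dec => w /(_ t t0') dw; rewrite /f.
have hlog := potential_log b1 q0 q1 qb.
have E : time_integral X (fun y => heat_kernel (2 * b)^-1 (y - x)) t w =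
    time_integral X source t w - time_integral X lap t w.
  have <- := time_integralB cX t w Csource Clap.
  rewrite (_ : (fun y => heat_kernel _ _) = fun y => source y - lap y)//.
  by apply/funext => y; rewrite lapE opprB [RHS]addrC subrK.
have S0 : 0 <= time_integral X source t w by exact: time_integral_ge0.
have S1 : time_integral X source t w <= time_integral X (fun=> 1) t w.
  exact: (le_time_integral cX).
have p0 : 0 <= pairing (X t w) phi by exact: pairing_ge0.
rewrite E (_ : time_integral X lap t w = pairing (X t w) phi - phi 0 - M t w).
  have mt := normr_le1Dsqr (M t w).
  exact: normr_tanaka_le S0 S1 p0 mt hlog.
have solve (A B C D : R) : A = B + C + D -> D = A - B - C by move=> ->; ring.
exact: solve dw.
Qed.

End potential_estimates.

End super_brownian_motion_from_a_point.

(** * Renormalized local time *)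

Lemma sqdistC (R : realType) (x y : R * R) : sqdist x y = sqdist y x.
Proof. by rewrite /sqdist -(sqrrN (y.1 - x.1)) -(sqrrN (y.2 - x.2)) !opprB. Qed.

Lemma sqr_enorm (R : realType) (x : R * R) : enorm x ^+ 2 = sqdist x 0.
Proof.
by rewrite /enorm sqr_sqrtr ?addr_ge0 ?sqr_ge0// /sqdist/= !sub0r !sqrrN.
Qed.

Lemma enorm_gt0 (R : realType) (x : R * R) : x != 0 -> 0 < enorm x.
Proof.
move=> x0; rewrite sqrtr_gt0 lt_neqAle addr_ge0 ?sqr_ge0// andbT eq_sym.
rewrite paddr_eq0 ?sqr_ge0// !sqrf_eq0; apply: contra x0.
by case: x => u v /= /andP[/eqP -> /eqP ->].
Qed.

Theorem theorem2 (R : realType) (d : measure_display)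
    (Omega : measurableType d) (P : probability Omega R)
    (F : R -> set_system Omega) (X : R -> Omega -> MF R)
    (L : R -> R * R -> Omega -> R)
    (hX : super_brownian_motion P F (\d_(0 : (R * R)%type)) X)
    (hL : local_time P X L) (t : R) (ht : 0 < t) :
  (limf_esup (fun x : R * R =>
     'E_P[fun w => `|L t x w - pi^-1 * ln (enorm x)^-1|%R]) (0 : R * R)%R^' < +oo)%E.
Proof.
pose K := 10 + 4 * t + 4 / t.
have bound (x : R * R) : x != 0 -> sqdist x 0 <= 1 ->
    ('E_P[fun w => `|L t x w - pi^-1 * ln (enorm x)^-1|%R] <= K%:E)%E.
  move=> x0 q1; have e0 := enorm_gt0 x0; have qE := sqr_enorm x.
  have q0 : 0 < sqdist x 0 by rewrite -qE exprn_gt0.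
  have -> : pi^-1 * ln (enorm x)^-1 = (2 * pi)^-1 * - ln (sqdist x 0).
    rewrite -qE lnXn// lnV ?posrE//.
    have := lt0r_neq0 (pi_gt0 R); move: (pi : R) (ln (enorm x)) => c l c0.
    by field.
  have [mL cvgL] := hL t x (ltW ht) x0.
  (* Mollification at time [1/(2 (b n))], which tends to [0] while
     [b n >= 1/|x|^2] keeps the bound uniform in [x]. *)
  pose b n : R := n.+2%:R + (sqdist x 0)^-1.
  have qV : 0 < (sqdist x 0)^-1 by rewrite invr_gt0.
  have b1 n : 1 < b n.
    have : 2 <= n.+2%:R :> R by rewrite ler_nat.
    by rewrite /b; lra.
  have qb n : (sqdist x 0)^-1 <= b n by rewrite lerDr.
  pose f n w := `|time_integral X (fun y => heat_kernel (2 * b n)^-1 (y - x)) t w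
      - (2 * pi)^-1 * - ln (sqdist x 0)|.
  have hf n : exists2 a, has_mean P (f n) a & a <= K.
    exact: (mean_heat_occupation hX (b1 n) ht q0 q1 (qb n)).
  rewrite unlock; apply: (@fatou_ae _ _ _ P f).
  - by move=> n; have [a /has_mean_measurable] := hf n.
  - by apply: measurableT_comp => //; exact: measurable_funB.
  - by move=> n w; exact: normr_ge0.
  - by move=> w; exact: normr_ge0.
  - apply: filterS cvgL => w /cvg_at_rightP cw.
    apply: cvg_norm; apply: cvgB; last exact: cvg_cst.
    apply: cw; split.
      by move=> n; rewrite invr_gt0 mulr_gt0//; have := b1 n; lra.
    apply: (@squeeze_cvgr _ _ _ _ (fun=> 0) harmonic); last 2 first.
    + exact: cvg_cst.
    + exact: cvg_harmonic.
    apply: nearW => n; rewrite invr_ge0 mulr_ge0//=; last by have := b1 n; lra.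
    rewrite lef_pV2 ?posrE ?ltr0n//; last by rewrite mulr_gt0//; have := b1 n; lra.
    have : n.+1%:R <= n.+2%:R :> R by rewrite ler_nat.
    by have := b1 n; rewrite /b; lra.
  - move=> n; have [a [_ ->] aK] := hf n; by rewrite lee_fin.
pose V : set (R * R) := [set x | x != 0 /\ sqdist x 0 <= 1].
have V0 : (0 : R * R)^' V.
  have c := @continuous_sqdist R 0 0.
  have : \forall x \near (0 : R * R), sqdist 0 x < 1.
    by apply: (cvgr_lt _ c); rewrite /sqdist subrr expr0n/= addr0.
  apply: filterS => x x1 x0; split => //.
  by rewrite sqdistC ltW.
rewrite limf_esupE; apply: (@le_lt_trans _ _ K%:E); last exact: ltry.
apply: (@le_trans _ _ (ereal_sup [set 'E_P[fun w => `|L t x w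
    - pi^-1 * ln (enorm x)^-1|%R]%E | x in V])).
  by apply: ereal_inf_lbound; exists V.
by apply: ge_ereal_sup => _ [x [x0 x1] <-]; exact: bound.
Qed.
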